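(* Let $d\neq0$, $\zeta,f\in\mathbb{R}$ (with $d\in\mathbb{R}$) and $\kappa\ge\frac{1}{\sqrt3}$. If $\phi\in H^4(\mathbb{T})$, then the solution $a=a(x,t)$ of $$\mathrm{i}\,\partial_t a=-(\mathrm{i}-\zeta)a-da_{xx}-(1+\mathrm{i}\kappa)|a|^2a+\mathrm{i}f,\qquad a(0)=\phi,$$ is in $C(\mathbb{R}_+;H^4(\mathbb{T}))$ and converges in $H^1(\mathbb{T})$ to a constant as $t\to\infty$. In particular, all solutions of the stationary problem $$-da''-(\mathrm{i}-\zeta)a-(1+\mathrm{i}\kappa)|a|^2a+\mathrm{i}f=0,\qquad a(\cdot)=a(\cdot+2\pi),$$ are constant.
   Context: $\mathbb{T}$ is the one-dimensional torus, i.e. $[0,2\pi]$ with both ends identified (functions are complex-valued and $2\pi$-periodic in $x$), and $\mathbb{R}_+=[0,\infty)$. The solution of the initial value problem with $\phi\in H^4(\mathbb{T})$ is understood as the unique global solution $a\in C(\mathbb{R}_+,H^4(\mathbb{T}))\cap C^1(\mathbb{R}_+,H^2(\mathbb{T}))\cap C^2(\mathbb{R}_+,L^2(\mathbb{T}))$. Here $a(t)$ denotes the function $x\mapsto a(x,t)$. *)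

(* Defs.v *)
From mathcomp Require Import all_boot all_order all_algebra.
From mathcomp Require Import complex.
From mathcomp Require Import all_classical all_reals all_analysis.

Set Implicit Arguments.
Unset Strict Implicit.
Unset Printing Implicit Defensive.

Import Order.TTheory GRing.Theory Num.Theory.
Import numFieldNormedType.Exports.

Local Open Scope classical_set_scope.
Local Open Scope ring_scope.
Local Open Scope complex_scope.

Section Torus.
Context {R : realType}.
Implicit Types (f g : R -> R[i]) (a b : R -> R -> R[i]) (k m : nat).

Definition period : R := pi *+ 2.

(* One period; functions on the torus are periodic functions on R, and
   elements of L^2 and H^k are represented by functions, to be read modulo
   almost everywhere equality. *)
Definition cell : set R := [set` `[0, period]].

Definition cintegral f : R[i] :=
  (\int[lebesgue_measure]_(x in cell) complex.Re (f x))%R +i*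
  (\int[lebesgue_measure]_(x in cell) complex.Im (f x))%R.

Definition L2 f : Prop :=
  [/\ periodic f period,
      measurable_fun cell (fun x => complex.Re (f x)),
      measurable_fun cell (fun x => complex.Im (f x)) &
      lebesgue_measure.-integrable cell
        (fun x => (Normc.normc (f x) ^+ 2)%:E)].

Definition L2normsq f : R :=
  (\int[lebesgue_measure]_(x in cell) (Normc.normc (f x) ^+ 2))%R.

(* Real-valued test functions are enough, by complex linearity. *)
Definition test_function (psi : R -> R) : Prop :=
  periodic psi period /\ forall n x, derivable (psi^`(n))%classic x 1.

Definition is_weak_derivative f g : Prop :=
  forall psi, test_function psi ->
    cintegral (fun x => f x * (psi^`()%classic x)%:C) =
    - cintegral (fun x => g x * (psi x)%:C).

(* The square integrable weak derivative, unique up to a.e. equality;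
   a junk value when there is none. *)
Definition wderiv f : R -> R[i] :=
  xget (fun=> 0) [set g | L2 g /\ is_weak_derivative f g].

Definition wderivn k f : R -> R[i] := iter k wderiv f.

Definition sobolev k f : Prop :=
  L2 f /\ forall j, (j < k)%N ->
    exists g, L2 g /\ is_weak_derivative (wderivn j f) g.

(* Meaningful for [f] in H^k only. *)
Definition sobolev_norm k f : R :=
  Num.sqrt (\sum_(j < k.+1) L2normsq (wderivn j f)).

(* Curves are maps [a : R -> R -> R[i]], with [a t x] the value at time t and
   position x; only their values for t >= 0 matter. *)

Definition is_time_derivative k a b : Prop :=
  forall t, 0 <= t -> sobolev k (b t) /\
    sobolev_norm k (fun x => ((s - t)^-1)%:C * (a s x - a t x) - b t x)
      @[s --> within [set s | 0 <= s /\ s != t] (nbhs t)] --> (0 : R).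

Definition continuous_curve k a : Prop :=
  forall t, 0 <= t -> sobolev k (a t) /\
    sobolev_norm k (fun x => a s x - a t x)
      @[s --> within [set s | 0 <= s] (nbhs t)] --> (0 : R).

(* a \in C^m([0, +oo[, H^k) *)
Fixpoint Ccurve m k a : Prop :=
  if m is m'.+1 then
    (forall t, 0 <= t -> sobolev k (a t)) /\
    exists b, is_time_derivative k a b /\ Ccurve m' k b
  else continuous_curve k a.

Definition converges_at_infinity k a f : Prop :=
  (\forall t \near +oo, sobolev k (fun x => a t x - f x)) /\
  sobolev_norm k (fun x => a t x - f x) @[t --> +oo] --> (0 : R).

Definition global_solution (d zeta kappa f : R) (phi : R -> R[i]) a : Prop :=
  [/\ Ccurve 0 4 a, Ccurve 1 2 a, Ccurve 2 0 a,
      {ae lebesgue_measure, forall x, a 0 x = phi x} &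
      exists b, is_time_derivative 2 a b /\
        forall t, 0 <= t -> {ae lebesgue_measure, forall x,
          'i%C * b t x =
            - ('i%C - zeta%:C) * a t x - d%:C * wderivn 2 (a t) x
            - (1 + 'i%C * kappa%:C) * `|a t x| ^+ 2 * a t x + 'i%C * f%:C}].

Definition cderivable f : Prop := forall x : R,
  derivable (fun y => complex.Re (f y)) x 1 /\
  derivable (fun y => complex.Im (f y)) x 1.

Definition cderive f : R -> R[i] := fun x =>
  (fun y => complex.Re (f y))^`()%classic x +i* (fun y => complex.Im (f y))^`()%classic x.

Definition stationary_solution (d zeta kappa f : R) (u : R -> R[i]) : Prop :=
  [/\ periodic u period, cderivable u, cderivable (cderive u) &
      forall x,
        - d%:C * cderive (cderive u) x - ('i%C - zeta%:C) * u x
        - (1 + 'i%C * kappa%:C) * `|u x| ^+ 2 * u x + 'i%C * f%:C = 0].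

End Torus.

(* Main.v *)
Require Import Defs.
From mathcomp Require Import all_boot all_order all_algebra.
From mathcomp Require Import complex.
From mathcomp Require Import all_classical all_reals all_analysis.
From mathcomp Require Import measurable_realfun.
From mathcomp Require Import ring lra.

(** Written for the time derivative, the equation is
      a_t = - (1 + i zeta) a + i d a_xx + (i - kappa) |a|^2 a + f.
    Everything rests on one pointwise inequality, [cubic_dissipative]: for
    kappa >= 1 / sqrt 3 and complex numbers z, c with w = z - c,
      Re ((i - kappa) (|z|^2 z - |c|^2 c) conj w) <= - (kappa / 4) |w|^4.
    The differential of z |-> |z|^2 z is w |-> 2 |z|^2 w + z^2 conj w, whose
    image under multiplication by i - kappa is dissipative as soon as
    2 kappa >= |i - kappa|, that is 3 kappa^2 >= 1.

    Since i d a_xx is skew and the linear term contributes - |w|^2, the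
    difference w of two solutions, with beta = w_t, satisfies
      Re <w, beta> + |w|_2^2 + (kappa / 4) |w|_4^4 <= 0
    ([snapshot_dissipation]), so that |w(t)|_2 <= exp (- t) |w(0)|_2
    ([trajectory_contraction]). This contraction is applied twice:
    - to a constant solution, which exists by the intermediate value theorem
      ([exists_constant_solution]); it yields convergence in L^2;
    - to a time shift of the solution itself; dividing by the shift shows that
      a_t stays bounded in L^2 ([trajectory_velocity_bound]).

    For the H^1 norm there is no need to differentiate |a_x|_2^2 in time. With
    w = a - c and c the constant solution, pairing the equation with i w instead
    of w isolates d |w_x|_2^2; the remaining terms are a pairing of a_t with i w,
    which is at most a constant times |w|_2, and terms bounded by |w|_2^2 and
    |w|_4^4 ([snapshot_gradient]). The dissipation inequality itself controls the
    quartic term, by (kappa / 4) |w|_4^4 <= |<w, a_t>|. Hence every term decays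
    exponentially ([trajectory_decay]), and no Sobolev embedding is used.

    What these computations require of weak derivatives is integration by parts
    between two weakly differentiable functions ([rweak_ibp]) and uniqueness
    ([rweak_unique]). Both come from the lemma of du Bois-Reymond
    ([du_bois_reymond]): a weakly differentiable function is almost everywhere a
    constant plus a primitive, and for primitives integration by parts is
    Fubini's theorem.

    A stationary solution u is treated classically: with w = u - c, the function
    - d Im (u' conj w) is periodic and its derivative is at least |w|^2, which
    must therefore vanish ([stationary_solution_constant]). *)

Set Implicit Arguments.
Unset Strict Implicit.
Unset Printing Implicit Defensive.

Import Order.TTheory GRing.Theory Num.Theory.
Import numFieldNormedType.Exports.

Local Open Scope classical_set_scope.
Local Open Scope ring_scope.

(** * Square integrable real functions on one period *)

Section RealL2.
Context {R : realType}.
Notation mu := (@lebesgue_measure R).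
Notation D := (@cell R).
Implicit Types (u v f g : R -> R).

Lemma measurable_cell : measurable D.
Proof. exact: measurable_itv. Qed.

Lemma period_gt0 : 0 < (period : R).
Proof. by rewrite /period pmulrn_rgt0 ?pi_gt0. Qed.

Lemma mu_cell_fin : (mu D < +oo)%E.
Proof. by rewrite /= lebesgue_measure_itv/=; case: ifPn => // _; rewrite -EFinB ltry. Qed.

Definition integrable_on_cell f : Prop := mu.-integrable D (EFin \o f).

Definition rL2 u := measurable_fun D u /\ integrable_on_cell (fun x => u x ^+ 2).

Definition rint f : R := \int[mu]_(x in D) f x.

Lemma integrable_cell_measurable f : integrable_on_cell f -> measurable_fun D f.
Proof. by move=> /measurable_int /measurable_EFinP. Qed.

Lemma integrable_cell_le f g : measurable_fun D f -> integrable_on_cell g ->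
  (forall x, D x -> `|f x| <= g x) -> integrable_on_cell f.
Proof.
move=> mf ig fg; apply: (@le_integrable _ _ _ mu D measurable_cell _ (EFin \o g)) => //.
  exact/measurable_EFinP.
by move=> x Dx /=; rewrite lee_fin (le_trans (fg x Dx))// ler_norm.
Qed.

Lemma integrable_cell_cst (c : R) : integrable_on_cell (fun=> c).
Proof.
apply: measurable_bounded_integrable.
- exact: measurable_cell.
- exact: mu_cell_fin.
- exact: measurable_cst.
- by exists `|c|; split; [exact: num_real|move=> M cM x _; exact: ltW].
Qed.

Lemma integrable_cellD f g : integrable_on_cell f -> integrable_on_cell g ->
  integrable_on_cell (fun x => f x + g x).
Proof. move=> hf hg; exact: (@integrableD _ _ _ mu D measurable_cell
  (EFin \o f) (EFin \o g) hf hg). Qed.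

Lemma integrable_cellZ (c : R) f : integrable_on_cell f ->
  integrable_on_cell (fun x => c * f x).
Proof. move=> hf; exact: (@integrableZl _ _ _ mu D measurable_cell c (EFin \o f) hf). Qed.

Lemma integrable_cellN f : integrable_on_cell f ->
  integrable_on_cell (fun x => - f x).
Proof. move=> hf; exact: (@integrableN _ _ _ mu D (EFin \o f) hf). Qed.

Lemma integrable_cellB f g : integrable_on_cell f -> integrable_on_cell g ->
  integrable_on_cell (fun x => f x - g x).
Proof. move=> hf hg; exact: (@integrableB _ _ _ mu D measurable_cell
  (EFin \o f) (EFin \o g) hf hg). Qed.

Lemma rintD f g : integrable_on_cell f -> integrable_on_cell g ->
  rint (fun x => f x + g x) = rint f + rint g.
Proof. move=> hf hg; exact: (@RintegralD _ _ _ mu D f g measurable_cell hf hg). Qed.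

Lemma rintB f g : integrable_on_cell f -> integrable_on_cell g ->
  rint (fun x => f x - g x) = rint f - rint g.
Proof. move=> hf hg; exact: (@RintegralB _ _ _ mu D f g measurable_cell hf hg). Qed.

Lemma rintZ (c : R) f : integrable_on_cell f ->
  rint (fun x => c * f x) = c * rint f.
Proof. move=> hf; exact: (@RintegralZl _ _ _ mu D f c measurable_cell hf). Qed.

Lemma rintN f : integrable_on_cell f -> rint (fun x => - f x) = - rint f.
Proof.
move=> hf; rewrite -mulN1r -rintZ//; congr rint; apply/funext => x.
by rewrite mulN1r.
Qed.

Lemma eq_rint f g : (forall x, D x -> f x = g x) -> rint f = rint g.
Proof. by move=> fg; apply: eq_Rintegral => x; rewrite inE; exact: fg. Qed.

Lemma rint_cst (c : R) : rint (fun=> c) = c * period.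
Proof.
rewrite /rint Rintegral_cst; last exact: measurable_cell.
rewrite /= lebesgue_measure_itv/= lte_fin period_gt0/=.
by rewrite subr0.
Qed.

Lemma ae_imply (P Q : R -> Prop) : (forall x, P x -> Q x) ->
  {ae mu, forall x, P x} -> {ae mu, forall x, Q x}.
Proof. by apply: filterS; exact: (ae_filter_ringOfSetsType mu). Qed.

Lemma ae_imply2 (P Q S : R -> Prop) : (forall x, P x -> Q x -> S x) ->
  {ae mu, forall x, P x} -> {ae mu, forall x, Q x} -> {ae mu, forall x, S x}.
Proof. by apply: filterS2; exact: (ae_filter_ringOfSetsType mu). Qed.

Lemma ae_and (P Q : R -> Prop) : {ae mu, forall x, P x} ->
  {ae mu, forall x, Q x} -> {ae mu, forall x, P x /\ Q x}.
Proof. exact: ae_imply2. Qed.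

Lemma ae_eq_rint f g : measurable_fun D f -> measurable_fun D g ->
  {ae mu, forall x, D x -> f x = g x} -> rint f = rint g.
Proof.
move=> mf mg fg; rewrite /rint /Rintegral; congr fine.
apply: ae_eq_integral.
- exact: measurable_cell.
- exact/measurable_EFinP.
- exact/measurable_EFinP.
by apply: ae_imply fg => x /= fg Dx; rewrite fg.
Qed.

Lemma ae_eq_integrable_cell f g : measurable_fun D g ->
  {ae mu, forall x, D x -> f x = g x} -> integrable_on_cell f ->
  integrable_on_cell g.
Proof.
move=> mg fg ifi; apply/integrableP; split; first exact/measurable_EFinP.
have /integrableP[mf foo] := ifi.
rewrite -(@ae_eq_integral _ _ _ mu D (fun x => `|(EFin \o g) x|%E)
  (fun x => `|(EFin \o f) x|%E)) //; first exact: measurable_cell.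
- exact: measurableT_comp.
- by apply: measurableT_comp => //; exact/measurable_EFinP.
by apply: ae_imply fg => x /= fg Dx; rewrite fg.
Qed.

Lemma rint_ge0 f : (forall x, D x -> 0 <= f x) -> 0 <= rint f.
Proof. exact: (@Rintegral_ge0 _ _ _ mu D f). Qed.

(** Pointwise monotonicity of the integral is transferred by replacing [g] with
    the maximum of [f] and [g], which is the same function up to a null set. *)
Lemma ae_le_rint f g : integrable_on_cell f -> integrable_on_cell g ->
  {ae mu, forall x, D x -> f x <= g x} -> rint f <= rint g.
Proof.
move=> hf hg fg.
have hm : integrable_on_cell (fun x => Num.max (f x) (g x)).
  apply: (integrable_cell_le (g := fun x => `|f x| + `|g x|)).
  - by apply: measurable_maxr; exact: integrable_cell_measurable.
  - by apply: (integrable_cellD (f := fun x => `|f x|) (g := fun x => `|g x|));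
      apply: integrable_norm.
  - move=> x _; rewrite /Num.max; case: ifP => _.
      by rewrite lerDr.
    by rewrite lerDl.
rewrite -(@ae_eq_rint (fun x => Num.max (f x) (g x)) g); last first.
- apply: ae_imply fg => x /= fg Dx.
  exact/max_r/fg.
- exact: integrable_cell_measurable.
- exact: integrable_cell_measurable.
apply: (@le_Rintegral _ _ _ mu D) => //; first exact: measurable_cell.
by move=> x _; rewrite le_max lexx.
Qed.

Lemma rL2M u v : rL2 u -> rL2 v -> integrable_on_cell (fun x => u x * v x).
Proof.
move=> [mu_ iu] [mv iv].
apply: (integrable_cell_le _ (integrable_cellD iu iv)).
  exact: measurable_funM.
move=> x _; rewrite ler_norml.
have := sqr_ge0 (u x + v x); have := sqr_ge0 (u x - v x).
have := sqr_ge0 (u x); have := sqr_ge0 (v x).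
by nra.
Qed.

Lemma rL2_cst (c : R) : rL2 (fun=> c).
Proof. by split; [exact: measurable_cst|exact: integrable_cell_cst]. Qed.

Lemma rL2_integrable u : rL2 u -> integrable_on_cell u.
Proof.
move=> hu; have := rL2M hu (rL2_cst 1).
by rewrite (_ : (fun x => u x * 1) = u)//; apply/funext => x; rewrite mulr1.
Qed.

Lemma rL2D u v : rL2 u -> rL2 v -> rL2 (fun x => u x + v x).
Proof.
move=> hu hv; split; first exact: measurable_funD hu.1 hv.1.
rewrite (_ : (fun x => _) = fun x => u x ^+ 2 + v x ^+ 2 + 2 * (u x * v x)).
  apply: integrable_cellD; last exact/integrable_cellZ/rL2M.
  exact: integrable_cellD hu.2 hv.2.
by apply/funext => x; ring.
Qed.

Lemma rL2Z (c : R) u : rL2 u -> rL2 (fun x => c * u x).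
Proof.
move=> hu; split; first exact: measurable_funM (measurable_cst _) hu.1.
rewrite (_ : (fun x => _) = fun x => c ^+ 2 * u x ^+ 2).
  exact/integrable_cellZ/hu.2.
by apply/funext => x; ring.
Qed.

Lemma rL2N u : rL2 u -> rL2 (fun x => - u x).
Proof.
move=> /(rL2Z (-1)); rewrite (_ : (fun x => -1 * u x) = (fun x => - u x))//.
by apply/funext => x; rewrite mulN1r.
Qed.

Lemma rL2B u v : rL2 u -> rL2 v -> rL2 (fun x => u x - v x).
Proof. by move=> hu /rL2N hv; exact: rL2D. Qed.

End RealL2.

(** * Smooth periodic functions: steps and antiderivatives *)

Section TestFunctions.
Context {R : realType}.
Notation mu := (@lebesgue_measure R).
Notation D := (@cell R).
Implicit Types (f g psi chi : R -> R) (b k : R).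

Lemma derive1_fun f g : (forall x : R, is_derive x 1 f (g x)) -> f^`()%classic = g.
Proof. by move=> fg; apply/funext => x; rewrite derive1E; exact: derive_val. Qed.

Lemma is_derive_congr f g (x df dg : R) : is_derive x 1 f df -> f = g -> df = dg ->
  is_derive x 1 g dg.
Proof. by move=> h <- <-. Qed.

(** A class of functions closed under differentiation consists of smooth
    functions. *)
Lemma derivable_class (S : set (R -> R)) :
  (forall f, S f -> exists g, S g /\ forall x : R, is_derive x 1 f (g x)) ->
  forall f, S f -> forall n x, derivable (f^`(n)%classic) x 1.
Proof.
move=> Sder f + n; elim: n f => [|n IHn] f Sf x.
  by have [g [_ fg]] := Sder f Sf; exact: (@ex_derive _ _ _ _ _ _ _ (fg x)).
have [g [Sg fg]] := Sder f Sf.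
by rewrite derive1Sn (derive1_fun fg); exact: IHn.
Qed.

(** On one period, cos (x - b) > cos b exactly for x between 0 and 2 b, so the
    logistic function of k (cos (x - b) - cos b) tends to the indicator of
    that interval as k grows, while remaining smooth and periodic. *)
Definition smooth_step b k (x : R) : R :=
  (1 + expR (- k * (cos (x - b) - cos b)))^-1.

(** The logistic function s satisfies s' = s (1 - s), so the algebra generated by
    the step and the trigonometric functions is closed under differentiation;
    this makes the step smooth without any formula for its higher
    derivatives. *)
Inductive step_algebra b k : (R -> R) -> Prop :=
| step_algebra_cst c : step_algebra b k (fun=> c)
| step_algebra_sin : step_algebra b k (fun x => sin (x - b))
| step_algebra_cos : step_algebra b k (fun x => cos (x - b))
| step_algebra_step : step_algebra b k (smooth_step b k)
| step_algebraD f g : step_algebra b k f -> step_algebra b k g ->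
    step_algebra b k (fun x => f x + g x)
| step_algebraM f g : step_algebra b k f -> step_algebra b k g ->
    step_algebra b k (fun x => f x * g x).

Lemma step_den_gt0 (y : R) : 0 < 1 + expR y.
Proof. by rewrite addr_gt0// expR_gt0. Qed.

Lemma is_derive_shift b (x : R) : is_derive x 1 (fun y : R => y + b) 1.
Proof.
have := @is_deriveD R R R id (cst b) x 1 1 0 _ _.
by rewrite addr0; apply.
Qed.

Lemma is_derive_subr_cst f (c x l : R) : is_derive x 1 f l ->
  is_derive x 1 (fun y => f y - c) l.
Proof.
move=> h; have := @is_deriveB R R R f (cst c) x 1 _ _ h (is_derive_cst _ _ _).
by rewrite subr0.
Qed.

Lemma periodic_derive f g (T : R) : periodic f T ->
  (forall x : R, is_derive x 1 f (g x)) -> periodic g T.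
Proof.
move=> pf df x.
have e : f = f \o (fun y => y + T) by apply/funext => y; rewrite /= pf.
have := @is_derive1_comp R f _ x _ _ (df (x + T)) (is_derive_shift T x).
rewrite -e mulr1 => h.
by rewrite -(@derive_val _ _ _ _ _ _ _ h) (@derive_val _ _ _ _ _ _ _ (df x)).
Qed.

Lemma is_derive_sin_shift b (x : R) :
  is_derive x 1 (fun y => sin (y - b)) (cos (x - b)).
Proof.
have h := is_derive_shift (- b) x.
by have := @is_derive1_comp R sin (fun y => y - b) x _ _ (is_derive_sin _) h;
  rewrite mulr1.
Qed.

Lemma is_derive_cos_shift b (x : R) :
  is_derive x 1 (fun y => cos (y - b)) (- sin (x - b)).
Proof.
have h := is_derive_shift (- b) x.
by have := @is_derive1_comp R cos (fun y => y - b) x _ _ (is_derive_cos _) h;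
  rewrite mulr1.
Qed.

Lemma is_derive_step b k (x : R) : is_derive x 1 (smooth_step b k)
  (- k * sin (x - b) * (smooth_step b k x * (1 + -1 * smooth_step b k x))).
Proof.
have h0 := is_derive_cos_shift b x.
have h1 : is_derive x 1 (fun y => - k * (cos (y - b) - cos b)) (k * sin (x - b)).
  have hb := is_derive_subr_cst (cos b) h0.
  apply: (is_derive_congr (@is_deriveM R R (cst (- k)) _ x 1 _ _ (is_derive_cst _ _ _) hb)).
    by [].
  by rewrite /GRing.scale/=; ring.
have h2 := @is_derive1_comp R expR _ x _ _ (is_derive_expR _) h1.
have h3 := @is_deriveD R R R (cst 1) _ x 1 _ _ (is_derive_cst _ _ _) h2.
have h4 := @is_deriveV R _ x _ 1 _ h3.
have /h4 {h4} : (cst 1 + expR \o (fun y => - k * (cos (y - b) - cos b))) x != 0.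
  by rewrite gt_eqF//; exact: step_den_gt0.
move/is_derive_congr; apply; first by [].
rewrite /smooth_step /GRing.scale/= add0r fctE /=.
have := step_den_gt0 (- k * (cos (x - b) - cos b)).
move: (expR _) => e he.
by field; rewrite gt_eqF.
Qed.

Lemma step_algebra_derive b k f : step_algebra b k f ->
  exists g, step_algebra b k g /\ forall x : R, is_derive x 1 f (g x).
Proof.
elim.
- move=> c; exists (fun=> 0); split; first exact: step_algebra_cst.
  by move=> x; exact: is_derive_cst.
- exists (fun x => cos (x - b)); split; first exact: step_algebra_cos.
  exact: is_derive_sin_shift.
- exists (fun x => -1 * sin (x - b)); split.
    exact: (step_algebraM (step_algebra_cst _ _ _) (step_algebra_sin _ _)).
  by move=> x; rewrite mulN1r; exact: is_derive_cos_shift.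
- exists (fun x => - k * sin (x - b) *
      (smooth_step b k x * (1 + -1 * smooth_step b k x))); split.
    apply: (@step_algebraM b k (fun x => - k * sin (x - b))).
      exact: (step_algebraM (step_algebra_cst _ _ _) (step_algebra_sin _ _)).
    apply: step_algebraM; first exact: step_algebra_step.
    apply: (@step_algebraD b k (fun=> 1)); first exact: step_algebra_cst.
    exact: (step_algebraM (step_algebra_cst _ _ _) (step_algebra_step _ _)).
  by move=> x; exact: is_derive_step.
- move=> f1 f2 _ [g1 [a1 d1]] _ [g2 [a2 d2]].
  exists (fun x => g1 x + g2 x); split; first exact: step_algebraD.
  by move=> x; exact: (@is_deriveD R R R f1 f2 x 1 _ _ (d1 x) (d2 x)).
- move=> f1 f2 s1 [g1 [a1 d1]] s2 [g2 [a2 d2]].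
  exists (fun x => f1 x * g2 x + f2 x * g1 x); split.
    by apply: step_algebraD; exact: step_algebraM.
  by move=> x; exact: (@is_deriveM R R f1 f2 x 1 _ _ (d1 x) (d2 x)).
Qed.

Lemma test_function_step b k : test_function (smooth_step b k).
Proof.
split.
  by move=> x; rewrite /smooth_step addrAC /period cosD2pi.
apply: (derivable_class (@step_algebra_derive b k)); exact: step_algebra_step.
Qed.

Lemma step_ge0 b k x : 0 <= smooth_step b k x.
Proof. by rewrite /smooth_step invr_ge0 ltW// step_den_gt0. Qed.

Lemma step_le1 b k x : smooth_step b k x <= 1.
Proof.
by rewrite /smooth_step invf_le1 ?step_den_gt0// lerDl expR_ge0.
Qed.

Lemma test_function_derivable psi : test_function psi ->
  forall x : R, is_derive x 1 psi (psi^`()%classic x).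
Proof.
move=> [_ /(_ 0%N)]; rewrite derive1n0 => h x.
by rewrite derive1E; apply: DeriveDef => //; exact: h.
Qed.

Lemma test_function_derive psi : test_function psi ->
  test_function (psi^`()%classic).
Proof.
move=> tp; split; last by move=> n x; rewrite -derive1Sn; exact: tp.2.
exact: periodic_derive tp.1 (test_function_derivable tp).
Qed.

Lemma is_derive_continuous f g : (forall x : R, is_derive x 1 f (g x)) -> continuous f.
Proof.
move=> fg x; apply: differentiable_continuous; apply/derivable1_diffP.
exact: (@ex_derive _ _ _ _ _ _ _ (fg x)).
Qed.

Lemma test_function_continuous psi : test_function psi -> continuous psi.
Proof. by move=> /test_function_derivable /is_derive_continuous. Qed.

Lemma test_function_cst (c : R) : test_function (fun=> c).
Proof.
split=> //; apply: (derivable_class (@step_algebra_derive 0 0)).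
exact: step_algebra_cst.
Qed.

Lemma continuous_measurable_cell f : continuous f -> measurable_fun D f.
Proof.
move=> cf; apply: subspace_continuous_measurable_fun; first exact: measurable_cell.
exact: continuous_subspaceT.
Qed.

Lemma continuous_integrable_cell f : continuous f -> integrable_on_cell f.
Proof.
move=> cf; apply: continuous_compact_integrable; first exact: segment_compact.
exact: continuous_subspaceT.
Qed.

Lemma continuous_rL2 f : continuous f -> rL2 f.
Proof.
move=> cf; split; first exact: continuous_measurable_cell.
apply: continuous_integrable_cell => x.
by rewrite /continuous_at; under eq_fun do rewrite expr2; rewrite expr2; apply: cvgM; exact: cf.
Qed.

Lemma FTC2_everywhere f F (a b : R) : a < b -> continuous f ->
  (forall x : R, is_derive x 1 F (f x)) ->
  \int[mu]_(x in `[a, b]) f x = F b - F a.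
Proof.
move=> ab cf dF; rewrite /Rintegral (@continuous_FTC2 R f F a b)//.
- exact: continuous_subspaceT.
- have cF := is_derive_continuous dF.
  split.
  + by move=> x _; exact: (@ex_derive _ _ _ _ _ _ _ (dF x)).
  + exact/cvg_at_right_filter/cF.
  + exact/cvg_at_left_filter/cF.
- by move=> x _; rewrite derive1E; exact: derive_val.
Qed.

Lemma rint_derive_test psi : test_function psi -> rint (psi^`()%classic) = 0.
Proof.
move=> tp; have cp := test_function_continuous (test_function_derive tp).
have := FTC2_everywhere period_gt0 cp (test_function_derivable tp).
by rewrite -[X in psi X](add0r period) tp.1 subrr.
Qed.

(** The integral from a fixed base point is an antiderivative only to the right
    of that point. Normalizing its value at 0 makes it independent of the base
    point, which may then be chosen to the left of any given x. *)
Lemma continuous_antiderivative f : continuous f ->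
  exists F, forall x : R, is_derive x 1 F (f x).
Proof.
move=> cf.
have fint (a b : R) : mu.-integrable `[a, b] (EFin \o f).
  by apply: continuous_compact_integrable; [exact: segment_compact|exact: continuous_subspaceT].
pose G a x := \int[mu]_(t in `[a, x]) f t.
have GB (a a' x y : R) : a' <= a -> a <= x -> a <= y -> G a' x - G a x = G a' y - G a y.
  move=> a'a ax ay.
  have key z : a <= z -> G a' z - G a z = G a' a.
    move=> az; have := @Rintegral_itvB R f (BLeft a') (BRight z) a (fint _ _).
    rewrite !bnd_simp => /(_ a'a az).
    rewrite Rintegral_itv_obnd_cbnd; last first.
      by apply: integrableS (fint a z) => //; apply: subset_itvr; rewrite bnd_simp.
    by rewrite -/(G a z) => <-; rewrite /G; ring.
  by rewrite !key.
(* any base point to the left of both x and 0 would do *)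
pose base (x : R) : R := - `|x| - 1.
have bl x : base x < x by rewrite /base; have := ler_norm (- x); rewrite normrN; lra.
have b0 x : base x < 0 by rewrite /base; have := normr_ge0 x; lra.
exists (fun x => G (base x) x - G (base x) 0) => x.
pose a := base x - 1.
have ax : a < x by rewrite /a; have := bl x; lra.
have a0 : a < 0 by rewrite /a; have := b0 x; lra.
have [dG G'] := @continuous_FTC1_closed R f a x (x + 1)
  ltac:(by rewrite ltrDl) (fint _ _) ax (cf x).
have dGa : is_derive x 1 (G a) (f x).
  by apply: DeriveDef => //; rewrite -derive1E.
have h : is_derive x 1 (fun y => G a y - G a 0) (f x).
  exact: is_derive_subr_cst.
apply: (near_eq_is_derive _ h); near=> y.
have ay : a <= base y.
  rewrite /a /base; have yx : `|x - y| < 1.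
    by near: y; exact: (nbhsx_ballx x 1 ltr01).
  by have := lerB_dist y x; rewrite distrC in yx; lra.
have := GB (base y) a y 0 ay (ltW (bl y)) (ltW (b0 y)).
lra.
Unshelve. all: by end_near. Qed.

(** The zero mean is what makes the antiderivative periodic. *)
Lemma test_function_antiderivative chi : test_function chi -> rint chi = 0 ->
  exists psi, test_function psi /\ psi^`()%classic = chi.
Proof.
move=> tc chi0; have [psi dpsi] := continuous_antiderivative (test_function_continuous tc).
have e := derive1_fun dpsi.
exists psi; split=> //; split; last first.
  case=> [|n] x; first by exact: (@ex_derive _ _ _ _ _ _ _ (dpsi x)).
  by rewrite derive1Sn e; exact: tc.2.
pose h := fun x => psi (x + period) - psi x.
have dh (x : R) : is_derive x 1 h 0.
  have := @is_derive1_comp R psi _ x _ _ (dpsi (x + period)) (is_derive_shift period x).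
  rewrite mulr1 tc.1 => h1.
  have := @is_deriveB R R R _ _ x 1 _ _ h1 (dpsi x).
  by rewrite subrr; apply.
move=> x; apply/eqP; rewrite -subr_eq0.
rewrite -/(h x) (is_derive_0_is_cst x 0 dh) /h add0r.
have := FTC2_everywhere period_gt0 (test_function_continuous tc) dpsi.
by move=> <-; exact/eqP.
Qed.

End TestFunctions.

(** * The lemma of du Bois-Reymond *)

Section DuBoisReymond.
Context {R : realType}.
Notation mu := (@lebesgue_measure R).
Notation D := (@cell R).
Implicit Types (f g q psi chi : R -> R) (b k : R).

Lemma ae_neq (c : R) : {ae mu, forall x, x != c}.
Proof.
exists [set c]; split; first exact: measurable_set1.
  exact: lebesgue_measure_set1.
by move=> x /= /negP; rewrite negbK => /eqP.
Qed.

(** In this product the first factor is positive inside the period, and the sign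
    of the second one compares x with 2 b. *)
Lemma cosB_prod (x b : R) :
  cos (x - b) - cos b = 2 * (sin (x / 2) * sin (b - x / 2)).
Proof.
have e1 : cos (x - b) = cos (x / 2 - (b - x / 2)) by congr cos; lra.
have e2 : cos b = cos (x / 2 + (b - x / 2)) by congr cos; lra.
by rewrite e1 e2 (cosB (x / 2)) (cosD (x / 2)); ring.
Qed.

Lemma cos_gap_gt0 (x b : R) : 0 < x -> x < b *+ 2 -> b < pi ->
  0 < cos (x - b) - cos b.
Proof.
rewrite mulr2n => x0 xb bpi; rewrite cosB_prod mulr_gt0// mulr_gt0//; apply: sin_gt0_pi; lra.
Qed.

Lemma cos_gap_lt0 (x b : R) : b *+ 2 < x -> x < period -> 0 < b ->
  cos (x - b) - cos b < 0.
Proof.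
rewrite /period !mulr2n => xt xp b0; rewrite cosB_prod.
have -> : b - x / 2 = - (x / 2 - b) by lra.
rewrite sinN mulrN mulrN oppr_lt0 mulr_gt0// mulr_gt0//; apply: sin_gt0_pi; lra.
Qed.

Lemma logistic_cvg1 (h : R) : 0 < h ->
  ((1 + expR (- n%:R * h))^-1 : R) @[n --> \oo] --> (1 : R).
Proof.
move=> h0.
have e : (expR (- h) ^+ n : R) @[n --> \oo] --> (0 : R).
  by apply: cvg_expr; rewrite ger0_norm ?expR_ge0// expR_lt1 oppr_lt0.
have e1 : (1 + expR (- h) ^+ n : R) @[n --> \oo] --> (1 + 0 : R).
  by apply: cvgD => //; exact: cvg_cst.
suff : ((1 + expR (- n%:R * h))^-1 : R) @[n --> \oo] --> ((1 + 0)^-1 : R).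
  by rewrite addr0 invr1.
have -> : (fun n => (1 + expR (- n%:R * h))^-1 : R) =
    (fun n => (1 + expR (- h) ^+ n)^-1).
  by apply/funext => n; rewrite -expRM_natl mulNr mulrN.
by apply: cvgV e1; rewrite addr0 oner_neq0.
Qed.

Lemma smooth_step_cvg (x b : R) : 0 < b -> b < pi -> 0 < x -> x < period ->
  x != b *+ 2 ->
  smooth_step b n%:R x @[n --> \oo] --> (\1_(`[0, b *+ 2]) x : R).
Proof.
move=> b0 bpi x0 xp xb; rewrite indicE; have [xlt|xgt] := ltP x (b *+ 2).
  rewrite mem_set/=; last by rewrite in_itv/= (ltW x0) (ltW xlt).
  exact: (logistic_cvg1 (cos_gap_gt0 x0 xlt bpi)).
have {xb}xgt : b *+ 2 < x by rewrite lt_neqAle eq_sym xb.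
rewrite memNset/=; last by rewrite in_itv/= => /andP[_]; rewrite leNgt xgt.
have h : 0 < - (cos (x - b) - cos b) by rewrite oppr_gt0; exact: cos_gap_lt0.
(* to the right of 2 b the step is 1 minus a logistic function tending to 1 *)
suff : smooth_step b n%:R x @[n --> \oo] --> (1 - 1 : R) by rewrite subrr.
have -> : (fun n => smooth_step b n%:R x) =
    (fun n => 1 - (1 + expR (- n%:R * - (cos (x - b) - cos b)))^-1).
  apply/funext => n; rewrite /smooth_step !mulrN mulNr opprK expRN.
  move: (expR_gt0 (n%:R * (cos (x - b) - cos b))); move: (expR _) => e e0.
  by field; rewrite !gt_eqF//; lra.
by apply: cvgB; [exact: cvg_cst|exact: logistic_cvg1].
Qed.

Lemma rint_step_cvg q (b : R) : integrable_on_cell q -> 0 < b -> b < pi ->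
  rint (fun x => q x * smooth_step b n%:R x) @[n --> \oo] -->
  \int[mu]_(x in `[0, b *+ 2]) q x.
Proof.
move=> iq b0 bpi.
have mq := integrable_cell_measurable iq.
have mE : measurable (`[0, b *+ 2] : set R) by exact: measurable_itv.
have sub : `[0, b *+ 2] `<=` D.
  move=> x /=; rewrite /cell/= !in_itv/= => /andP[-> xb]/=.
  by apply: (le_trans xb); rewrite /period lerMn2r ltW.
have -> : \int[mu]_(x in `[0, b *+ 2]) q x =
    rint (fun x => q x * \1_(`[0, b *+ 2]) x).
  rewrite /rint -(setIidr sub) Rintegral_mkcondr; apply: eq_Rintegral => x _.
  by rewrite patchE indicE (setIidr sub); case: ifP => _; rewrite ?mulr1 ?mulr0.
rewrite /rint /Rintegral; apply: fine_cvg.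
have mstep n : measurable_fun D (smooth_step b n%:R).
  apply: continuous_measurable_cell; apply: test_function_continuous.
  exact: test_function_step.
have mind : measurable_fun D (\1_(`[0, b *+ 2]) : R -> R).
  by apply: measurable_funTS; exact: measurable_indic.
have mqs n : measurable_fun D (fun x => q x * smooth_step b n%:R x).
  exact: measurable_funM mq (mstep n).
have mqi : measurable_fun D (fun x => q x * \1_(`[0, b *+ 2]) x).
  exact: measurable_funM mq mind.
have := @dominated_convergence _ _ R mu D measurable_cell
  (fun n x => (q x * smooth_step b n%:R x)%:E)
  (fun x => (q x * \1_(`[0, b *+ 2]) x)%:E) (fun x => `|q x|%:E).
case.
- by move=> n; apply/measurable_EFinP; exact: (mqs n).
- by apply/measurable_EFinP; exact: mqi.
- have h : {ae mu, forall x, (x != 0 /\ x != period) /\ x != b *+ 2}.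
    exact: ae_and (ae_and (ae_neq 0) (ae_neq period)) (ae_neq (b *+ 2)).
  apply: ae_imply h => x [[x0 xp] xb]; rewrite /cell/= in_itv/= => /andP[x0' xp'].
  apply/cvg_EFin; first by near=> n.
  apply: cvgM; first exact: cvg_cst.
  by apply: smooth_step_cvg => //; rewrite lt_neqAle ?x0' ?xp' ?xp // eq_sym x0.
- exact: integrable_norm.
- apply: aeW => x n _; rewrite /= lee_fin normrM ler_piMr//.
  by rewrite ger0_norm ?step_ge0// step_le1.
move=> ifin _; rewrite fineK; last exact: (@integrable_fin_num _ _ R mu D measurable_cell _ ifin).
by apply.
Unshelve. all: by end_near. Qed.

Lemma test_functionB_cst chi (c : R) : test_function chi ->
  test_function (fun x => chi x - c).
Proof.
move=> tc; have e (x : R) : is_derive x 1 (fun y => chi y - c) (chi^`()%classic x).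
  exact/is_derive_subr_cst/test_function_derivable.
split; first by move=> x; rewrite tc.1.
case=> [|n] x; first exact: (@ex_derive _ _ _ _ _ _ _ (e x)).
by rewrite derive1Sn (derive1_fun e) -derive1Sn; exact: tc.2.
Qed.

Lemma integrable_cellM_continuous q chi : integrable_on_cell q -> continuous chi ->
  integrable_on_cell (fun x => q x * chi x).
Proof.
move=> iq cc.
apply: (@integrableMl _ _ R mu D measurable_cell (EFin \o q) chi iq).
  exact: continuous_measurable_cell.
have /compact_bounded [M [Mr bM]] : compact (chi @` D).
  by apply: continuous_compact; [exact: continuous_subspaceT|exact: segment_compact].
by exists M; split => // x Mx y Dy; apply: (bM _ Mx); exists y.
Qed.

(** A test function minus its mean is the derivative of a test function, so q
    integrates any test function like the constant mean m of q. Passing to the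
    limit along the steps, the integral of q from 0 to y is m y for every y in
    the period; Lebesgue's differentiation theorem identifies q with m almost
    everywhere. *)
Lemma du_bois_reymond q : integrable_on_cell q ->
  (forall psi, test_function psi -> rint (fun x => q x * psi^`()%classic x) = 0) ->
  {ae mu, forall x, D x -> q x = rint q / period}.
Proof.
move=> iq qder; pose m := rint q / period.
have P0 := @period_gt0 R.
have qtest chi : test_function chi -> rint (fun x => q x * chi x) = m * rint chi.
  move=> tc; pose c := rint chi / period.
  have ichi := continuous_integrable_cell (test_function_continuous tc).
  have [|psi [tpsi epsi]] := test_function_antiderivative (test_functionB_cst c tc).
    rewrite rintB//; last exact: integrable_cell_cst.
    by rewrite rint_cst /c divfK ?subrr// gt_eqF.
  have := qder psi tpsi; rewrite epsi.
  rewrite (_ : (fun x => _) = fun x => q x * chi x - c * q x); last first.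
    by apply/funext => x; ring.
  rewrite rintB; last exact: integrable_cellZ; last first.
    apply: integrable_cellM_continuous => //; exact: test_function_continuous.
  by rewrite rintZ// => /eqP; rewrite subr_eq0 => /eqP ->; rewrite /c /m; ring.
have arc (b : R) : 0 < b -> b < pi -> \int[mu]_(x in `[0, b *+ 2]) q x = m * (b *+ 2).
  move=> b0 bpi.
  have h1 := rint_step_cvg iq b0 bpi.
  have h2 := rint_step_cvg (integrable_cell_cst 1) b0 bpi.
  have h3 : (m * rint (smooth_step b n%:R)) @[n --> \oo] --> m * (b *+ 2).
    apply: cvgM; first exact: cvg_cst.
    move: h2; rewrite Rintegral_cst; last exact: measurable_itv.
    rewrite /= lebesgue_measure_itv/= lte_fin pmulrn_lgt0// b0 /= subr0 mul1r.
    by under eq_fun do under eq_fun do rewrite mul1r.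
  have e : (fun n => rint (fun x => q x * smooth_step b n%:R x)) =
      (fun n => m * rint (smooth_step b n%:R)).
    by apply/funext => n; rewrite qtest//; exact: test_function_step.
  by rewrite e in h1; exact: (cvg_unique _ h1 h3).
pose f := q \_ D.
have lf : locally_integrable setT f by apply: integrable_locally => //; exact: measurable_cell.
have fi : mu.-integrable setT (EFin \o f).
  have := (@integrable_mkcond _ _ R mu D (EFin \o q) measurable_cell).1 iq.
  by rewrite restrict_EFin.
have fiy (y : R) : mu.-integrable [set` Interval (BLeft 0) (BRight y)] (EFin \o f).
  by apply: integrableS fi => //; exact: measurable_itv.
have H := FTC1 fiy lf.
have h2 := ae_and (ae_neq (0 : R)) (ae_neq period).
apply: (ae_imply2 _ H h2) => x Hx [x0 xp].
rewrite /cell/= in_itv/= => /andP[x0' xp'].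
have {}x0 : 0 < x by rewrite lt_neqAle eq_sym x0.
have {}xp : x < period by rewrite lt_neqAle xp.
have [dF eF] := Hx x0; rewrite -/m.
have -> : q x = f x by rewrite /f patchE mem_set// /cell/= in_itv/= x0' xp'.
rewrite -eF derive1E.
suff h : is_derive x 1 (fun y => \int[mu]_(t in [set` Interval (BLeft 0) (BRight y)]) f t) m.
  exact: derive_val.
have hm : is_derive x 1 (fun y : R => m * y) m.
  have := @is_deriveM R R (cst m) id x 1 _ _ (is_derive_cst _ _ _) (is_derive_id _ _).
  by rewrite /GRing.scale/= mulr0 addr0 mulr1.
apply: near_eq_is_derive hm; near=> y.
have y0 : 0 < y by near: y; exact: lt_nbhsr.
have yp : y < period by near: y; exact: lt_nbhsl.
have y2 : 0 < y / 2 by lra.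
have yh : y / 2 < pi by move: yp; rewrite /period mulr2n => yp; lra.
have e2 : y / 2 *+ 2 = y by rewrite mulr2n; lra.
have := arc _ y2 yh; rewrite e2 => <-.
apply: eq_Rintegral => t; rewrite inE/= in_itv/= => /andP[t0 ty].
by rewrite /f patchE mem_set// /cell/= in_itv/= t0 (le_trans ty)// ltW.
Unshelve. all: by end_near. Qed.

End DuBoisReymond.

(** * Fubini's theorem for primitives *)

Section Primitive.
Context {R : realType}.
Notation mu := (@lebesgue_measure R).
Notation D := (@cell R).
Implicit Types (f g u v : R -> R).

Definition primitive f (x : R) : R := \int[mu]_(t in `[0, x]) f t.

Lemma integral_scaled_patch f (E : set R) (c : R) : integrable_on_cell f ->
  measurable E -> E `<=` D ->
  (\int[mu]_t (c * (f \_ E) t)%:E = (c * \int[mu]_(t in E) f t)%:E)%E.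
Proof.
move=> hf mE ED.
have fE : mu.-integrable E (EFin \o f).
  exact: (@integrableS _ _ R mu D E (EFin \o f) measurable_cell mE ED hf).
have fE' : mu.-integrable setT (EFin \o (f \_ E)).
  have := (@integrable_mkcond _ _ R mu E (EFin \o f) mE).1 fE.
  by rewrite restrict_EFin.
rewrite (_ : (fun t => _) = fun t => c%:E * (EFin \o (f \_ E)) t)%E; last first.
  by apply/funext => t; rewrite EFinM.
rewrite integralZl// EFinM; congr (_ * _)%E.
rewrite Rintegral_mkcond /Rintegral fineK//.
exact: (@integrable_fin_num _ _ R mu setT measurableT _ fE').
Qed.

Lemma integrable_tensor f g : mu.-integrable setT (EFin \o f) ->
  mu.-integrable setT (EFin \o g) ->
  (mu \x mu)%E.-integrable setT (fun z : R * R => (f z.1 * g z.2)%:E).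
Proof.
move=> hf hg.
have mf : measurable_fun setT f by move: hf => /measurable_int /measurable_EFinP.
have mg : measurable_fun setT g by move: hg => /measurable_int /measurable_EFinP.
have mfg : measurable_fun setT (fun z : R * R => (f z.1 * g z.2)%:E).
  apply/measurable_EFinP; apply: measurable_funM.
    exact: measurableT_comp mf measurable_fst.
  exact: measurableT_comp mg measurable_snd.
apply/(integrable12ltyP mu mu mfg).
have ng := integrable_norm hg; have nf := integrable_norm hf.
pose C := \int[mu]_y `|g y|.
rewrite (_ : (fun x => _) = fun x => C%:E * (`|f x|)%:E)%E; last first.
  apply/funext => x.
  rewrite (_ : (fun y => _) = fun y => `|f x|%:E * (EFin \o (Num.norm \o g)) y)%E; last first.
    by apply/funext => y; rewrite /= normrM EFinM.
  rewrite integralZl// muleC; congr (_ * _)%E.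
  by rewrite /C /Rintegral fineK// (@integrable_fin_num _ _ R mu setT measurableT _ ng).
rewrite integralZl// lte_mul_pinfty ?lee_fin//.
  by apply: Rintegral_ge0.
exact: (@integrable_lty _ _ R mu setT measurableT _ nf).
Qed.

(** Both sides are the integral of f (x) g (y) over the triangle 0 <= y <= x. *)
Lemma fubini_primitive f g : integrable_on_cell f -> integrable_on_cell g ->
  integrable_on_cell (fun x => f x * primitive g x) /\
  rint (fun x => f x * primitive g x) =
  rint (fun x => g x * \int[mu]_(t in `[x, period]) f t).
Proof.
move=> hf hg; have mD := @measurable_cell R.
pose F := f \_ D; pose G := g \_ D.
have iF : mu.-integrable setT (EFin \o F).
  have := (@integrable_mkcond _ _ R mu D (EFin \o f) mD).1 hf.
  by rewrite restrict_EFin.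
have iG : mu.-integrable setT (EFin \o G).
  have := (@integrable_mkcond _ _ R mu D (EFin \o g) mD).1 hg.
  by rewrite restrict_EFin.
(* f and g are extended by 0 outside the period, so that h lives on the whole plane *)
pose h (z : R * R) : \bar R := (if z.2 <= z.1 then F z.1 * G z.2 else 0)%:E.
have ih : (mu \x mu)%E.-integrable setT h.
  apply: le_integrable (integrable_tensor iF iG) => //; last first.
    by move=> z _ /=; rewrite lee_fin; case: ifP => _; rewrite ?normr0.
  apply/measurable_EFinP; apply: measurable_fun_ifT.
  - by apply: measurable_fun_ler; [exact: measurable_snd|exact: measurable_fst].
  - have := measurable_int _ (integrable_tensor iF iG).
    by move/measurable_EFinP.
  - exact: measurable_cst.
have DP (x : R) : D x -> 0 <= x <= period by rewrite /cell/= in_itv.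
have PD (x : R) : 0 <= x <= period -> D x by rewrite /cell/= in_itv.
have FE x : F x = if 0 <= x <= period then f x else 0.
  rewrite /F patchE; case: (boolP (0 <= x <= period)) => [xD|/negP nDx'].
    by rewrite mem_set//; exact: PD.
  by rewrite memNset//; apply: contra_not nDx' => /DP.
have GE x : G x = if 0 <= x <= period then g x else 0.
  rewrite /G patchE; case: (boolP (0 <= x <= period)) => [xD|/negP nDx'].
    by rewrite mem_set//; exact: PD.
  by rewrite memNset//; apply: contra_not nDx' => /DP.
have hx (x : R) : (\int[mu]_y h (x, y) = (F x * primitive g x)%:E)%E.
  have [Dx|nDx] := boolP (0 <= x <= period); last first.
    rewrite FE (negbTE nDx) mul0r integral0_eq// => y _.
    by rewrite /h FE/= (negbTE nDx) mul0r if_same.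
  rewrite -(@integral_scaled_patch g `[0, x] (F x))//; last first.
    by move=> y /=; rewrite in_itv/= => /andP[y0 yx]; apply: PD; lra.
  apply: eq_integral => y _; congr EFin; rewrite /h/= GE patchE.
  have [yx|xy] := leP y x; last first.
    rewrite memNset ?mulr0//= in_itv/= => /andP[_]; lra.
  have [y0|y0] := leP 0 y => /=; last first.
    by rewrite memNset//= in_itv/= => /andP[]; lra.
  by rewrite ifT ?mem_set//= ?in_itv/= ?y0//; lra.
have hy (y : R) : (\int[mu]_x h (x, y) = (G y * \int[mu]_(t in `[y, period]) f t)%:E)%E.
  have [Dy|nDy] := boolP (0 <= y <= period); last first.
    rewrite GE (negbTE nDy) mul0r integral0_eq// => x _.
    by rewrite /h GE/= (negbTE nDy) mulr0 if_same.
  rewrite -(@integral_scaled_patch f `[y, period] (G y))//; last first.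
    by move=> x /=; rewrite in_itv/= => /andP[y0 yx]; apply: PD; lra.
  apply: eq_integral => x _; congr EFin; rewrite /h/= FE patchE.
  have [yx|xy] := leP y x; last first.
    by rewrite memNset ?mulr0//= in_itv/= => /andP[+ _]; lra.
  have [xP|xP] := leP x period; last first.
    rewrite andbF mul0r memNset ?mulr0//= in_itv/= => /andP[]; lra.
  have x0 : 0 <= x by lra.
  by rewrite x0 mem_set/= ?in_itv/= ?yx ?xP// mulrC.
have e := Fubini ih.
have i1 : mu.-integrable setT (fun x => (F x * primitive g x)%:E).
  by have := integrable_fubini_F ih; apply: eq_integrable => // x _; exact: hx.
have restr (a b c : R -> R) : (forall x, a x = if 0 <= x <= period then c x else 0) ->
    (fun x => a x * b x) = (fun x => c x * b x) \_ D.
  move=> ac; apply/funext => x; rewrite patchE ac.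
  case: (boolP (0 <= x <= period)) => [xD|/negP nDx'].
    by rewrite mem_set//; exact: PD.
  by rewrite memNset ?mul0r//; apply: contra_not nDx' => /DP.
have re1 := restr _ (primitive g) _ FE.
have re2 := restr _ (fun y => \int[mu]_(t in `[y, period]) f t) _ GE.
split.
- apply: (@integrable_mkcond _ _ R mu D _ mD).2; rewrite restrict_EFin -re1; exact: i1.
- have -> : rint (fun x => f x * primitive g x) = \int[mu]_x (F x * primitive g x).
    by rewrite re1; exact: Rintegral_mkcond.
  have -> : rint (fun x => g x * \int[mu]_(t in `[x, period]) f t) =
      \int[mu]_x (G x * \int[mu]_(t in `[x, period]) f t).
    by rewrite re2; exact: Rintegral_mkcond.
  rewrite /Rintegral; congr fine.
  transitivity (\int[mu]_x \int[mu]_y h (x, y))%E.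
    by apply: eq_integral => x _; rewrite hx.
  by rewrite e; apply: eq_integral => x _; rewrite hy.
Qed.

End Primitive.

(** * Weak derivatives of real functions *)

Section WeakDerivative.
Context {R : realType}.
Notation mu := (@lebesgue_measure R).
Notation D := (@cell R).
Implicit Types (f g u v psi : R -> R).

Lemma integrable_primitive g : integrable_on_cell g ->
  integrable_on_cell (primitive g).
Proof.
move=> hg; have [+ _] := fubini_primitive (integrable_cell_cst 1) hg.
by rewrite (_ : (fun x => 1 * primitive g x) = primitive g)//; apply/funext => x; rewrite mul1r.
Qed.

Lemma primitive_ibp f g : integrable_on_cell f -> integrable_on_cell g ->
  rint (fun x => f x * primitive g x) + rint (fun x => g x * primitive f x) =
  rint f * rint g.
Proof.
move=> hf hg; have [_ ->] := fubini_primitive hf hg.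
have [ig _] := fubini_primitive hg hf.
rewrite (@eq_rint _ _ (fun x => rint f * g x - g x * primitive f x)); last first.
  move=> x; rewrite /cell/= in_itv/= => /andP[x0 xP].
  have := @Rintegral_itvB R f (BLeft 0) (BRight period) x hf.
  rewrite !bnd_simp => /(_ x0 xP).
  rewrite Rintegral_itv_obnd_cbnd; last first.
    apply: (@integrableS _ _ R mu D) hf; [exact: measurable_cell|exact: measurable_itv|].
    by apply: subset_itvr; rewrite bnd_simp.
  move=> <-; rewrite /primitive /rint /cell; ring.
rewrite rintB//; last exact: integrable_cellZ.
by rewrite rintZ//; ring.
Qed.

(** The relation that weak differentiability of a complex function imposes on its
    real part and on its imaginary part. *)
Definition rweak u g := forall psi, test_function psi ->
  rint (fun x => u x * psi^`()%classic x) = - rint (fun x => g x * psi x).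

Lemma derive1_cst_fun (c : R) : (fun _ : R => c)^`()%classic = (fun=> 0).
Proof. by apply: derive1_fun => x; exact: is_derive_cst. Qed.

(** Test against the constant 1. *)
Lemma rweak_mean0 u g : rweak u g -> rint g = 0.
Proof.
move=> /(_ _ (test_function_cst 1)); rewrite derive1_cst_fun.
under eq_fun do rewrite mulr0; rewrite rint_cst mul0r => /eqP.
rewrite eq_sym oppr_eq0 => /eqP; under eq_fun do rewrite mulr1.
exact.
Qed.

(** By [primitive_ibp], the primitive of g also has weak derivative g; the
    difference is then orthogonal to all derivatives of test functions and
    du Bois-Reymond's lemma applies. *)
Lemma rweak_primitive u g : integrable_on_cell u -> integrable_on_cell g -> rweak u g ->
  exists c, {ae mu, forall x, D x -> u x = c + primitive g x}.
Proof.
move=> hu hg ug; have g0 := rweak_mean0 ug.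
have hG := integrable_primitive hg.
have hq := integrable_cellB hu hG.
exists (rint (fun x => u x - primitive g x) / period).
have dbr : {ae mu, forall x, D x -> u x - primitive g x =
    rint (fun x => u x - primitive g x) / period}; last first.
  by apply: ae_imply dbr => x h Dx; rewrite -h//; ring.
apply: du_bois_reymond hq _ => psi tpsi.
have tpsi1 := test_function_derive tpsi.
have cpsi1 := test_function_continuous tpsi1.
have cpsi := test_function_continuous tpsi.
have i1 := integrable_cellM_continuous hu cpsi1.
have i2 := integrable_cellM_continuous hG cpsi1.
have i3 := integrable_cellM_continuous hg cpsi.
under eq_fun do rewrite mulrBl.
rewrite rintB// (ug _ tpsi).
have := primitive_ibp (continuous_integrable_cell cpsi1) hg.
rewrite g0 mulr0.
rewrite (@eq_rint _ (fun x => g x * primitive _ x)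
  (fun x => g x * psi x - psi 0 * g x)); last first.
  move=> x; rewrite /cell/= in_itv/= => /andP[]; rewrite le_eqVlt => /predU1P[<- _|x0 _].
    by rewrite /primitive set_itv1 Rintegral_set1; ring.
  rewrite /primitive (FTC2_everywhere x0 cpsi1 (test_function_derivable tpsi)).
  by ring.
rewrite rintB//; last exact: integrable_cellZ.
rewrite rintZ// g0 mulr0 subr0.
rewrite (_ : (fun x => psi^`()%classic x * _) =
  (fun x => primitive g x * psi^`()%classic x)); last first.
  by apply/funext => x; rewrite mulrC.
by move=> h; rewrite -opprD addrC h oppr0.
Qed.

(** Replace u and v by constants plus primitives of u1 and v1. The constants do
    not contribute because u1 and v1 have mean 0, and for the primitives the
    boundary term of [primitive_ibp] is a product of these means. *)
Lemma rweak_ibp u u1 v v1 : rL2 u -> rL2 u1 -> rL2 v -> rL2 v1 ->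
  rweak u u1 -> rweak v v1 ->
  rint (fun x => u1 x * v x) = - rint (fun x => u x * v1 x).
Proof.
move=> hu hu1 hv hv1 wu wv.
have iu1 := rL2_integrable hu1; have iv1 := rL2_integrable hv1.
have [c uc] := rweak_primitive (rL2_integrable hu) iu1 wu.
have [c' vc] := rweak_primitive (rL2_integrable hv) iv1 wv.
have mU := integrable_cell_measurable (integrable_primitive iu1).
have mV := integrable_cell_measurable (integrable_primitive iv1).
have [i1 _] := fubini_primitive iu1 iv1.
have [i2 _] := fubini_primitive iv1 iu1.
rewrite (@ae_eq_rint _ _ (fun x => c' * u1 x + u1 x * primitive v1 x)); first last.
- by apply: ae_imply vc => x h Dx; rewrite h//; ring.
- apply: integrable_cell_measurable; apply: integrable_cellD => //.
  exact: integrable_cellZ.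
- exact: measurable_funM hu1.1 hv.1.
rewrite (@ae_eq_rint _ (fun x => u x * v1 x)
    (fun x => c * v1 x + v1 x * primitive u1 x)); first last.
- by apply: ae_imply uc => x h Dx; rewrite h//; ring.
- apply: integrable_cell_measurable; apply: integrable_cellD => //.
  exact: integrable_cellZ.
- exact: measurable_funM hu.1 hv1.1.
rewrite !rintD//; do ?exact: integrable_cellZ.
rewrite !rintZ// (rweak_mean0 wu) (rweak_mean0 wv) !mulr0 !add0r.
have := primitive_ibp iu1 iv1.
by rewrite (rweak_mean0 wu) mul0r => /eqP; rewrite addr_eq0 => /eqP.
Qed.

Lemma rweak_unique u g h : integrable_on_cell g -> integrable_on_cell h ->
  rweak u g -> rweak u h -> {ae mu, forall x, D x -> g x = h x}.
Proof.
move=> ig ih wg wh; have igh := integrable_cellB ig ih.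
have q0 psi : test_function psi -> rint (fun x => (g x - h x) * psi x) = 0.
  move=> tpsi; have cpsi := test_function_continuous tpsi.
  under eq_fun do rewrite mulrBl.
  rewrite rintB; [|exact: integrable_cellM_continuous|exact: integrable_cellM_continuous].
  by apply/eqP; rewrite subr_eq0 -eqr_opp -(wg _ tpsi) -(wh _ tpsi).
have dbr : {ae mu, forall x, D x -> g x - h x = rint (fun x => g x - h x) / period}.
  apply: du_bois_reymond igh _ => psi tpsi.
  exact/q0/test_function_derive.
apply: ae_imply dbr => x e Dx; apply/eqP; rewrite -subr_eq0 e//.
by rewrite rintB// (rweak_mean0 wg) (rweak_mean0 wh) subrr mul0r.
Qed.

Lemma rweak_cst (c : R) : rweak (fun=> c) (fun=> 0).
Proof.
move=> psi tpsi; rewrite rintZ; last first.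
  exact/continuous_integrable_cell/test_function_continuous/test_function_derive.
rewrite rint_derive_test// mulr0.
by under eq_fun do rewrite mul0r; rewrite rint_cst mul0r oppr0.
Qed.

Lemma rweakB u g v h : rL2 u -> rL2 g -> rL2 v -> rL2 h -> rweak u g -> rweak v h ->
  rweak (fun x => u x - v x) (fun x => g x - h x).
Proof.
move=> hu hg hv hh wu wv psi tpsi.
have tp2 := continuous_rL2 (test_function_continuous tpsi).
have tp3 := continuous_rL2 (test_function_continuous (test_function_derive tpsi)).
under eq_fun do rewrite mulrBl; rewrite rintB; try exact: rL2M.
under [in RHS]eq_fun do rewrite mulrBl; rewrite rintB; try exact: rL2M.
by rewrite wu// wv//; ring.
Qed.

End WeakDerivative.

(** * The real Hilbert space of complex L2 functions *)

Section ComplexL2.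
Context {R : realType}.
Notation mu := (@lebesgue_measure R).
Notation D := (@cell R).
Implicit Types (u v w g : R -> R[i]%C).

Lemma normc_sqr (z : R[i]%C) :
  Normc.normc z ^+ 2 = complex.Re z ^+ 2 + complex.Im z ^+ 2.
Proof. by case: z => x y /=; rewrite sqr_sqrtr// addr_ge0 ?sqr_ge0. Qed.

Lemma Re_realM (c : R) (z : R[i]%C) : complex.Re (c%:C%C * z) = c * complex.Re z.
Proof. by case: z => x y /=; rewrite mul0r subr0. Qed.

Lemma Im_realM (c : R) (z : R[i]%C) : complex.Im (c%:C%C * z) = c * complex.Im z.
Proof. by case: z => x y /=; rewrite mul0r addr0. Qed.

Lemma ReD (z z' : R[i]%C) : complex.Re (z + z') = complex.Re z + complex.Re z'.
Proof. by case: z => x y; case: z'. Qed.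

Lemma ImD (z z' : R[i]%C) : complex.Im (z + z') = complex.Im z + complex.Im z'.
Proof. by case: z => x y; case: z'. Qed.

Lemma ReB (z z' : R[i]%C) : complex.Re (z - z') = complex.Re z - complex.Re z'.
Proof. by case: z => x y; case: z'. Qed.

Lemma ImB (z z' : R[i]%C) : complex.Im (z - z') = complex.Im z - complex.Im z'.
Proof. by case: z => x y; case: z'. Qed.

Lemma L2_Re u : L2 u -> rL2 (fun x => complex.Re (u x)).
Proof.
move=> [_ mr mi iu]; split=> //.
apply: (integrable_cell_le _ iu).
  exact: measurable_funX.
by move=> x _; rewrite normc_sqr ger0_norm ?sqr_ge0// lerDl sqr_ge0.
Qed.

Lemma L2_Im u : L2 u -> rL2 (fun x => complex.Im (u x)).
Proof.
move=> [_ mr mi iu]; split=> //.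
apply: (integrable_cell_le _ iu).
  exact: measurable_funX.
by move=> x _; rewrite normc_sqr ger0_norm ?sqr_ge0// lerDr sqr_ge0.
Qed.

Lemma L2_intro u : periodic u period -> rL2 (fun x => complex.Re (u x)) ->
  rL2 (fun x => complex.Im (u x)) -> L2 u.
Proof.
move=> pu [mr ir] [mi ii]; split=> //.
have -> : (fun x => (Normc.normc (u x) ^+ 2)%:E) =
    EFin \o (fun x => complex.Re (u x) ^+ 2 + complex.Im (u x) ^+ 2).
  by apply/funext => x; rewrite normc_sqr.
exact: integrable_cellD.
Qed.

Lemma L2D u v : L2 u -> L2 v -> L2 (fun x => u x + v x).
Proof.
move=> hu hv; apply: L2_intro.
- by move=> x; case: hu => -> _ _ _; case: hv => ->.
- by under eq_fun do rewrite ReD; apply: rL2D; exact: L2_Re.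
- by under eq_fun do rewrite ImD; apply: rL2D; exact: L2_Im.
Qed.

Lemma L2B u v : L2 u -> L2 v -> L2 (fun x => u x - v x).
Proof.
move=> hu hv; apply: L2_intro.
- by move=> x; case: hu => -> _ _ _; case: hv => ->.
- by under eq_fun do rewrite ReB; apply: rL2B; exact: L2_Re.
- by under eq_fun do rewrite ImB; apply: rL2B; exact: L2_Im.
Qed.

Lemma L2Z (c : R) u : L2 u -> L2 (fun x => c%:C%C * u x).
Proof.
move=> hu; apply: L2_intro.
- by move=> x; case: hu => ->.
- by under eq_fun do rewrite Re_realM; apply: rL2Z; exact: L2_Re.
- by under eq_fun do rewrite Im_realM; apply: rL2Z; exact: L2_Im.
Qed.

Lemma L2_cst (c : R[i]%C) : L2 (fun=> c).
Proof. by apply: L2_intro => //; exact: rL2_cst. Qed.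

(** The real part of the Hermitian product: energies are derived through the
    underlying real Hilbert space. *)
Definition inner u v : R :=
  rint (fun x => complex.Re (u x) * complex.Re (v x) +
                 complex.Im (u x) * complex.Im (v x)).

Lemma integrable_inner u v : L2 u -> L2 v ->
  integrable_on_cell (fun x => complex.Re (u x) * complex.Re (v x) +
                 complex.Im (u x) * complex.Im (v x)).
Proof.
move=> hu hv; apply: integrable_cellD.
  by apply: (rL2M (L2_Re hu) (L2_Re hv)).
by apply: (rL2M (L2_Im hu) (L2_Im hv)).
Qed.

Lemma L2normsqE u : L2normsq u = inner u u.
Proof.
rewrite -[LHS]/(rint (fun x => Normc.normc (u x) ^+ 2)).
by apply: eq_rint => x _; rewrite normc_sqr !expr2.
Qed.

Lemma L2normsq_ge0 u : 0 <= L2normsq u.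
Proof. by apply: Rintegral_ge0 => x _; exact: sqr_ge0. Qed.

Lemma innerDr u v w : L2 u -> L2 v -> L2 w ->
  inner u (fun x => v x + w x) = inner u v + inner u w.
Proof.
move=> hu hv hw; rewrite /inner -rintD; try exact: integrable_inner.
by apply: eq_rint => x _; rewrite ReD ImD; ring.
Qed.

Lemma innerZr (c : R) u v : L2 u -> L2 v ->
  inner u (fun x => c%:C%C * v x) = c * inner u v.
Proof.
move=> hu hv; rewrite /inner -rintZ; last exact: integrable_inner.
by apply: eq_rint => x _; rewrite Re_realM Im_realM; ring.
Qed.

Lemma innerC u v : inner u v = inner v u.
Proof. by apply: eq_rint => x _; ring. Qed.

Lemma L2normsq_lin (c : R) u v : L2 u -> L2 v ->
  L2normsq (fun x => u x + c%:C%C * v x) =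
  L2normsq u + 2 * c * inner u v + c ^+ 2 * L2normsq v.
Proof.
move=> hu hv; have hV := L2Z c hv; have hW := L2D hu hV; rewrite !L2normsqE.
rewrite (innerDr hW hu hV) (innerC _ u) (innerC _ (fun x => c%:C%C * v x)).
rewrite (innerDr hu hu hV) (innerDr hV hu hV) (innerC _ u).
by rewrite (innerZr c hu hv)
  (innerZr c hV hv) (innerC (fun x => c%:C%C * v x) v) (innerZr c hv hv); ring.
Qed.

Lemma L2normsqZ (c : R) u : L2 u ->
  L2normsq (fun x => c%:C%C * u x) = c ^+ 2 * L2normsq u.
Proof.
move=> hu; have hcu := L2Z c hu.
by rewrite !L2normsqE (innerZr c hcu hu) (innerC _ u) (innerZr c hu hu); ring.
Qed.

Lemma eq_L2normsq u v : (forall x, u x = v x) -> L2normsq u = L2normsq v.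
Proof. by move=> uv; congr L2normsq; apply/funext. Qed.

Lemma L2normsqD_le u v : L2 u -> L2 v ->
  L2normsq (fun x => u x + v x) <= 2 * L2normsq u + 2 * L2normsq v.
Proof.
move=> hu hv.
have h1 := L2normsq_lin 1 hu hv; have h2 := L2normsq_lin (-1) hu hv.
have := L2normsq_ge0 (fun x => u x + (-1)%:C%C * v x).
rewrite (@eq_L2normsq (fun x => u x + v x) (fun x => u x + 1%:C%C * v x)); last first.
  by move=> x; rewrite (_ : 1%:C%C = 1) ?mul1r.
rewrite h1 h2; lra.
Qed.

(** The weight [c] allows pairing an exponentially small factor with a merely
    bounded one; this replaces the Cauchy-Schwarz inequality throughout. *)
Lemma inner_young (c : R) u v : 0 < c -> L2 u -> L2 v ->
  `|2 * inner u v| <= c * L2normsq u + c^-1 * L2normsq v.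
Proof.
move=> c0 hu hv.
have h1 := L2normsq_lin c^-1 hu hv; have h2 := L2normsq_lin (- c^-1) hu hv.
have := L2normsq_ge0 (fun x => u x + (c^-1)%:C%C * v x).
have := L2normsq_ge0 (fun x => u x + (- c^-1)%:C%C * v x).
rewrite h1 h2 => /(mulr_ge0 (ltW c0)) k1 /(mulr_ge0 (ltW c0)) k2.
have e1 : c * (L2normsq u + 2 * - c^-1 * inner u v + (- c^-1) ^+ 2 * L2normsq v) =
  c * L2normsq u - 2 * inner u v + c^-1 * L2normsq v by field; rewrite gt_eqF.
have e2 : c * (L2normsq u + 2 * c^-1 * inner u v + (c^-1) ^+ 2 * L2normsq v) =
  c * L2normsq u + 2 * inner u v + c^-1 * L2normsq v by field; rewrite gt_eqF.
by rewrite ler_norml; apply/andP; split; lra.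
Qed.

Lemma weak_Re u g : is_weak_derivative u g ->
  rweak (fun x => complex.Re (u x)) (fun x => complex.Re (g x)).
Proof.
move=> h psi /h [hr _].
transitivity (rint (fun x => complex.Re (u x * (psi^`()%classic x)%:C%C))).
  by apply: eq_rint => x _; rewrite mulrC -Re_realM mulrC.
rewrite [LHS]hr; congr (- _).
by apply: eq_rint => x _; rewrite mulrC Re_realM mulrC.
Qed.

Lemma weak_Im u g : is_weak_derivative u g ->
  rweak (fun x => complex.Im (u x)) (fun x => complex.Im (g x)).
Proof.
move=> h psi /h [_ hr].
transitivity (rint (fun x => complex.Im (u x * (psi^`()%classic x)%:C%C))).
  by apply: eq_rint => x _; rewrite mulrC -Im_realM mulrC.
rewrite [LHS]hr; congr (- _).
by apply: eq_rint => x _; rewrite mulrC Im_realM mulrC.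
Qed.

Lemma weak_intro u g :
  rweak (fun x => complex.Re (u x)) (fun x => complex.Re (g x)) ->
  rweak (fun x => complex.Im (u x)) (fun x => complex.Im (g x)) ->
  is_weak_derivative u g.
Proof.
move=> hr hi psi tpsi.
have e v (chi : R -> R) : cintegral (fun x => v x * (chi x)%:C%C) =
    ((rint (fun x => complex.Re (v x) * chi x)) +i*
     (rint (fun x => complex.Im (v x) * chi x)))%C.
  rewrite /cintegral; congr (_ +i* _)%C; apply: eq_rint => x _.
    by rewrite mulrC Re_realM mulrC.
  by rewrite mulrC Im_realM mulrC.
by rewrite !e hr// hi.
Qed.

Lemma weakB u g v h : L2 u -> L2 g -> L2 v -> L2 h ->
  is_weak_derivative u g -> is_weak_derivative v h ->
  is_weak_derivative (fun x => u x - v x) (fun x => g x - h x).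
Proof.
move=> hu hg hv hh wu wv; apply: weak_intro.
  rewrite (funext (fun x => ReB (u x) (v x))) (funext (fun x => ReB (g x) (h x))).
  by apply: rweakB; (try exact: L2_Re); exact: weak_Re.
rewrite (funext (fun x => ImB (u x) (v x))) (funext (fun x => ImB (g x) (h x))).
by apply: rweakB; (try exact: L2_Im); exact: weak_Im.
Qed.

Lemma weak_cst (c : R[i]%C) : is_weak_derivative (fun=> c) (fun=> 0).
Proof. by apply: weak_intro; exact: rweak_cst. Qed.

Lemma weak_unique_normsq u g h : L2 g -> L2 h -> is_weak_derivative u g ->
  is_weak_derivative u h -> L2normsq g = L2normsq h.
Proof.
move=> hg hh wg wh.
have er := rweak_unique (rL2_integrable (L2_Re hg)) (rL2_integrable (L2_Re hh))
  (weak_Re wg) (weak_Re wh).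
have ei := rweak_unique (rL2_integrable (L2_Im hg)) (rL2_integrable (L2_Im hh))
  (weak_Im wg) (weak_Im wh).
rewrite !L2normsqE; apply: ae_eq_rint.
- by apply: integrable_cell_measurable; exact: integrable_inner.
- by apply: integrable_cell_measurable; exact: integrable_inner.
by apply: ae_imply (ae_and er ei) => x [e1 e2] Dx; rewrite e1// e2.
Qed.

End ComplexL2.

(** * Pointwise inequalities for the cubic term *)

Section Cubic.
Context {R : realFieldType}.

(** Real and imaginary parts of (i - kappa) |z|^2 z for z = p + i q. *)
Definition cubic_re (kappa p q : R) := - (p ^+ 2 + q ^+ 2) * (q + kappa * p).
Definition cubic_im (kappa p q : R) := (p ^+ 2 + q ^+ 2) * (p - kappa * q).

(** With w = z - c, m = Re (c conj w) + |w|^2 / 2 and v = Im (c conj w), the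
    difference of the two sides is exactly the quadratic form
    3 kappa m^2 + kappa v^2 + 2 m v, which is nonnegative if and only if
    3 kappa^2 >= 1. Here m belongs to the midpoint of the segment from c to z;
    the quartic term is the variance left over when the differential is averaged
    along that segment. *)
Lemma cubic_dissipative (kappa p q c1 c2 : R) : 0 < kappa -> 1 <= 3 * kappa ^+ 2 ->
  (cubic_re kappa p q - cubic_re kappa c1 c2) * (p - c1) +
  (cubic_im kappa p q - cubic_im kappa c1 c2) * (q - c2) <=
  - (kappa / 4 * ((p - c1) ^+ 2 + (q - c2) ^+ 2) ^+ 2).
Proof.
move=> k0 k3; rewrite /cubic_re /cubic_im.
pose x := p - c1; pose y := q - c2.
have -> : p = c1 + x by rewrite /x; ring.
have -> : q = c2 + y by rewrite /y; ring.
move: x y => x y.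
pose m := c1 * x + c2 * y + (x ^+ 2 + y ^+ 2) / 2.
pose v := c2 * x - c1 * y.
have form_ge0 : 0 <= 3 * kappa * m ^+ 2 + kappa * v ^+ 2 + 2 * m * v.
  rewrite -(pmulr_rge0 _ k0).
  have -> : kappa * (3 * kappa * m ^+ 2 + kappa * v ^+ 2 + 2 * m * v) =
    (kappa * v + m) ^+ 2 + (3 * kappa ^+ 2 - 1) * m ^+ 2 by ring.
  by rewrite addr_ge0 ?sqr_ge0// mulr_ge0 ?sqr_ge0// subr_ge0.
rewrite -subr_ge0; set e := (X in 0 <= X).
suff -> : e = 3 * kappa * m ^+ 2 + kappa * v ^+ 2 + 2 * m * v by [].
by rewrite /e /m /v; field.
Qed.

(** The component of the same product that the energy identity does not see. It
    has no sign; only its size in terms of |w|^2 and |w|^4 matters. *)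
Lemma cubic_cross (kappa p q c1 c2 : R) : 0 < kappa ->
  `|(cubic_re kappa p q - cubic_re kappa c1 c2) * (q - c2) -
    (cubic_im kappa p q - cubic_im kappa c1 c2) * (p - c1)| <=
  (9 + 3 * kappa) / 2 * (c1 ^+ 2 + c2 ^+ 2) * ((p - c1) ^+ 2 + (q - c2) ^+ 2) +
  (5 + kappa) / 2 * ((p - c1) ^+ 2 + (q - c2) ^+ 2) ^+ 2.
Proof.
move=> k0; rewrite /cubic_re /cubic_im.
pose x := p - c1; pose y := q - c2.
have -> : p = c1 + x by rewrite /x; ring.
have -> : q = c2 + y by rewrite /y; ring.
move: x y => x y.
pose u := c1 * x + c2 * y; pose v := c2 * x - c1 * y; pose r := x ^+ 2 + y ^+ 2.
set e := (X in `|X| <= _); set b := (X in _ <= X).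
have -> : e = - (3 * u ^+ 2 + 3 * u * r + r ^+ 2 + v ^+ 2) + kappa * (2 * u * v + r * v).
  by rewrite /e /u /v /r; ring.
have -> : b = (9 + 3 * kappa) / 2 * (u ^+ 2 + v ^+ 2) + (5 + kappa) / 2 * r ^+ 2.
  by rewrite /b /u /v /r; field.
have u2 := sqr_ge0 u; have v2 := sqr_ge0 v; have r2 := sqr_ge0 r.
have B1 : 2 * u * v + r * v <= 3 / 2 * (u ^+ 2 + v ^+ 2) + r ^+ 2 / 2.
  by have := sqr_ge0 (u - v); have := sqr_ge0 (r - v); nra.
have B2 : - (2 * u * v + r * v) <= 3 / 2 * (u ^+ 2 + v ^+ 2) + r ^+ 2 / 2.
  by have := sqr_ge0 (u + v); have := sqr_ge0 (r + v); nra.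
have K1 := ler_wpM2l (ltW k0) B1; have K2 := ler_wpM2l (ltW k0) B2.
have A1 := sqr_ge0 (u + r); have A2 := sqr_ge0 (u - r).
by rewrite ler_norml; apply/andP; split; nra.
Qed.

End Cubic.

(** * Energy and gradient estimates at a fixed time *)

Section SingleTime.
Context {R : realType}.
Notation mu := (@lebesgue_measure R).
Notation D := (@cell R).
(** [x] and [y] are the real and imaginary parts of the difference of two
    solutions, [x1], [y1] and [x2], [y2] their first and second space derivatives,
    [xt], [yt] their time derivatives. The differences of the cubic terms are
    expressed through the equation as [n1] and [n2]; in this way they are square
    integrable without any further argument. *)
Variables (d zeta kappa : R) (x y x1 y1 x2 y2 xt yt : R -> R).
Hypotheses (hx : rL2 x) (hy : rL2 y) (hx1 : rL2 x1) (hy1 : rL2 y1)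
  (hx2 : rL2 x2) (hy2 : rL2 y2) (hxt : rL2 xt) (hyt : rL2 yt).
Hypotheses (wx : rweak x x1) (wy : rweak y y1) (wx1 : rweak x1 x2) (wy1 : rweak y1 y2).
Hypothesis k0 : 0 < kappa.

Let n1 t := xt t + x t - zeta * y t + d * y2 t.
Let n2 t := yt t + y t + zeta * x t - d * x2 t.
Let r t := x t ^+ 2 + y t ^+ 2.

Hypothesis diss : {ae mu, forall t, D t ->
  n1 t * x t + n2 t * y t <= - (kappa / 4 * r t ^+ 2)}.

Let ir : integrable_on_cell r.
Proof. exact: integrable_cellD hx.2 hy.2. Qed.

Let hn1 : rL2 n1.
Proof.
apply: rL2D; last exact: rL2Z.
by apply: rL2B; [exact: rL2D|exact: rL2Z].
Qed.

Let hn2 : rL2 n2.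
Proof.
apply: rL2B; last exact: rL2Z.
by apply: rL2D; [exact: rL2D|exact: rL2Z].
Qed.

Let nl t := n1 t * x t + n2 t * y t.

Let inl : integrable_on_cell nl.
Proof. by apply: integrable_cellD; exact: rL2M. Qed.

(** Dissipation dominates |w|^4 by a sum of products of square integrable
    functions. *)
Lemma integrable_quartic : integrable_on_cell (fun t => r t ^+ 2).
Proof.
have mr := integrable_cell_measurable ir.
pose g t := Num.max (r t ^+ 2) (- (4 / kappa) * nl t).
have mr2 : measurable_fun D (fun t => r t ^+ 2) by exact: measurable_funX.
have inl' := integrable_cellZ (- (4 / kappa)) inl.
have mg : measurable_fun D g.
  by apply: measurable_maxr => //; exact: integrable_cell_measurable.
have ig : integrable_on_cell g.
  apply: ae_eq_integrable_cell inl' => //.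
  apply: ae_imply diss => t h Dt; apply/esym/max_r.
  have := h Dt; rewrite -/(nl t) => h'.
  rewrite mulNr -mulrN mulrAC ler_pdivlMr//; lra.
apply: integrable_cell_le mr2 ig _ => t _.
by rewrite ger0_norm ?sqr_ge0// /g le_max lexx.
Qed.

(** The dispersive terms y2 x and x2 y have the same integral, by integration by
    parts, so that only the cubic and damping terms remain. *)
Lemma energy_dissipation :
  rint (fun t => xt t * x t + yt t * y t) + rint r +
  kappa / 4 * rint (fun t => r t ^+ 2) <= 0.
Proof.
have iq := integrable_quartic.
have ib : integrable_on_cell (fun t => xt t * x t + yt t * y t).
  by apply: integrable_cellD; exact: rL2M.
have e : rint nl = rint (fun t => xt t * x t + yt t * y t) + rint r.
  pose s t := d * (y2 t * x t) - d * (x2 t * y t).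
  have i1 := integrable_cellZ d (rL2M hy2 hx).
  have i2 := integrable_cellZ d (rL2M hx2 hy).
  have is_ : integrable_on_cell s by exact: integrable_cellB.
  have -> : nl = fun t => (xt t * x t + yt t * y t) + r t + s t.
    by apply/funext => t; rewrite /nl /n1 /n2 /r /s; ring.
  rewrite rintD//; last exact: integrable_cellD.
  rewrite rintD// rintB// !rintZ; try exact: rL2M.
  rewrite (rweak_ibp hy1 hy2 hx hx1 wy1 wx) (rweak_ibp hx1 hx2 hy hy1 wx1 wy).
  rewrite (@eq_rint _ (fun t => x1 t * y1 t) (fun t => y1 t * x1 t)); last first.
    by move=> t _; rewrite mulrC.
  by rewrite subrr addr0.
rewrite -e -rintZ// -rintD//; last exact: integrable_cellZ.
rewrite -[leRHS](mul0r period) -(rint_cst 0).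
apply: ae_le_rint; [|exact: integrable_cell_cst|].
  by apply: integrable_cellD => //; exact: integrable_cellZ.
apply: ae_imply diss => t h Dt; have := h Dt; rewrite -/(nl t); lra.
Qed.

(** Pairing with i w rather than w keeps the dispersive term: x2 x + y2 y integrates
    to minus the square of the gradient. *)
Lemma gradient_bound (A B : R) :
  {ae mu, forall t, D t -> `|n1 t * y t - n2 t * x t| <= A * r t + B * r t ^+ 2} ->
  `|d| * rint (fun t => x1 t ^+ 2 + y1 t ^+ 2) <=
  `|rint (fun t => xt t * y t - yt t * x t)| + (`|zeta| + A) * rint r +
  B * rint (fun t => r t ^+ 2).
Proof.
move=> cross; have iq := integrable_quartic.
have ib : integrable_on_cell (fun t => xt t * y t - yt t * x t).
  by apply: integrable_cellB; exact: rL2M.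
pose c t := n1 t * y t - n2 t * x t.
have ic : integrable_on_cell c.
  exact: (integrable_cellB (rL2M hn1 hy) (rL2M hn2 hx)).
have i1 := rL2M hx2 hx; have i2 := rL2M hy2 hy.
have e : d * rint (fun t => x1 t ^+ 2 + y1 t ^+ 2) =
    rint (fun t => xt t * y t - yt t * x t) - zeta * rint r - rint c.
  have -> : c = fun t => ((xt t * y t - yt t * x t) - zeta * r t) +
      d * (x2 t * x t + y2 t * y t).
    by apply/funext => t; rewrite /c /n1 /n2 /r; ring.
  rewrite [rint (fun t => _ + d * _)]rintD; last 2 first.
  - exact: (integrable_cellB ib (integrable_cellZ zeta ir)).
  - by apply: integrable_cellZ; exact: integrable_cellD.
  rewrite [rint (fun t => _ - zeta * _)]rintB//; last exact: integrable_cellZ.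
  rewrite !rintZ//; last exact: integrable_cellD.
  rewrite [rint (fun t => x2 t * x t + _)]rintD//.
  rewrite (rweak_ibp hy1 hy2 hy hy1 wy1 wy) (rweak_ibp hx1 hx2 hx hx1 wx1 wx).
  rewrite rintD; [|exact: hx1.2|exact: hy1.2].
  by under eq_fun do rewrite expr2; under [X in _ * (_ + rint X)]eq_fun do rewrite expr2; ring.
have X0 : 0 <= rint (fun t => x1 t ^+ 2 + y1 t ^+ 2).
  by apply: rint_ge0 => t _; rewrite addr_ge0 ?sqr_ge0.
have r0 : 0 <= rint r by apply: rint_ge0 => t _; rewrite addr_ge0 ?sqr_ge0.
have bc : `|rint c| <= A * rint r + B * rint (fun t => r t ^+ 2).
  have ic' : integrable_on_cell (fun t => - c t) by exact: integrable_cellN.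
  have i3 : integrable_on_cell (fun t => A * r t + B * r t ^+ 2).
    by apply: integrable_cellD; exact: integrable_cellZ.
  rewrite -!rintZ// -rintD; [|exact: integrable_cellZ|exact: integrable_cellZ].
  rewrite ler_norml lerNl -rintN//; apply/andP; split; apply: ae_le_rint => //.
    apply: ae_imply cross => t h Dt; have := h Dt; rewrite -/(c t) ler_norml; lra.
  apply: ae_imply cross => t h Dt; have := h Dt; rewrite -/(c t) ler_norml; lra.
rewrite -[X in `|d| * X](ger0_norm X0) -normrM e.
set b := rint _; apply: (le_trans (ler_normB _ _)).
have := ler_normB b (zeta * rint r); rewrite normrM (ger0_norm r0) => h.
rewrite mulrDl; lra.
Qed.

End SingleTime.

(** * A differential inequality *)

Section Gronwall.
Context {R : realType}.
Implicit Types (N M : R -> R).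

(** A one-sided derivative at 0 and a two-sided one elsewhere, because curves are
    meaningful for nonnegative times only. *)
Definition has_slope N (t l : R) := forall e : R, 0 < e ->
  exists2 dl : R, 0 < dl & forall s : R, 0 <= s -> `|s - t| < dl ->
    `|N s - N t - (s - t) * l| <= e * `|s - t|.

Lemma is_derive_slope N (t l : R) :
  (forall e : R, 0 < e -> exists2 dl : R, 0 < dl & forall s : R, `|s - t| < dl ->
    `|N s - N t - (s - t) * l| <= e * `|s - t|) -> is_derive t 1 N l.
Proof.
move=> H.
have h : h^-1 *: (N (h *: 1 + t) - N t) @[h --> 0^'] --> l.
  apply/cvgrPdist_le => e e0.
  have [dl dl0 Hdl] := H e e0.
  near=> h.
  have h0 : h != 0 by near: h; exact: nbhs_dnbhs_neq.
  have hdl : `|h| < dl.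
    by near: h; exact: dnbhs0_lt.
  have := Hdl (h + t); rewrite addrK => /(_ hdl).
  rewrite /GRing.scale/= mulr1 => k.
  rewrite distrC -(ler_pM2r (x := `|h|)) ?normr_gt0// -normrM.
  apply: le_trans k; rewrite le_eqVlt; apply/orP; left; apply/eqP.
  by congr `|_|; field.
apply: DeriveDef; first by apply/cvg_ex; exists l.
exact: cvg_lim h.
Unshelve. all: by end_near. Qed.

Lemma gronwall N M : (forall t : R, 0 <= t -> has_slope N t (M t)) ->
  (forall t : R, 0 <= t -> M t <= - 2 * N t) ->
  forall t : R, 0 <= t -> N t <= expR (- 2 * t) * N 0.
Proof.
move=> sl dis T T0.
(* an affine continuation to negative times makes N differentiable at 0 as well *)
pose N' (t : R) := if 0 <= t then N t else N 0 + t * M 0.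
have dN (t : R) : 0 <= t -> is_derive t 1 N' (M t).
  move=> t0; apply: is_derive_slope => e e0.
  have [dl dl0 H] := sl t t0 e e0.
  have [t_eq0 | tn0] := eqVneq t 0.
    subst t.
    exists dl => // s sdl; rewrite /N' lexx.
    case: ifPn => [s0|_]; first exact: H.
    by rewrite subr0 (_ : _ - _ - _ = 0) ?normr0 ?mulr_ge0// ?(ltW e0)//; ring.
  have t1 : 0 < t by rewrite lt_neqAle eq_sym tn0.
  exists (Num.min dl t); first by rewrite lt_min dl0.
  move=> s; rewrite lt_min => /andP[sdl st]; rewrite /N' t0.
  have s0 : 0 <= s by move: st; rewrite ltr_norml; lra.
  by rewrite s0; exact: H.
have dE (t : R) : is_derive t 1 (fun y => expR (2 * y)) (2 * expR (2 * t)).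
  have h := @is_deriveM R R (cst 2) id t 1 _ _ (is_derive_cst _ _ _) (is_derive_id _ _).
  have := @is_derive1_comp R expR _ t _ _ (is_derive_expR _) h.
  move/is_derive_congr; apply=> //.
  by rewrite /GRing.scale/=; ring.
have dg (t : R) : 0 <= t -> is_derive t 1 (fun y => expR (2 * y) * N' y)
    (expR (2 * t) * (M t + 2 * N' t)).
  move=> t0; have := @is_deriveM R R _ _ t 1 _ _ (dE t) (dN t t0).
  move/is_derive_congr; apply=> //.
  by rewrite /GRing.scale/=; ring.
have := @ler0_derive1_nincr R (fun y => expR (2 * y) * N' y) 0 T _ _ _ 0 T (lexx _) T0 (lexx _).
rewrite mulr0 expR0 mul1r /N' lexx T0 => H.
rewrite mulNr expRN -ler_pdivrMl ?invr_gt0 ?expR_gt0// invrK.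
apply: H.
- by move=> t; rewrite in_itv/= => /andP[/ltW t0 _]; exact: (@ex_derive _ _ _ _ _ _ _ (dg t t0)).
- move=> t; rewrite in_itv/= => /andP[/ltW t0 _].
  rewrite derive1E (@derive_val _ _ _ _ _ _ _ (dg t t0)) mulr_ge0_le0 ?expR_ge0//.
  by have := dis t t0; rewrite /N' t0; lra.
- apply: derivable_within_continuous => t; rewrite in_itv/= => /andP[t0 _].
  exact: (@ex_derive _ _ _ _ _ _ _ (dg t t0)).
Qed.

End Gronwall.

(** * Contraction along trajectories *)

Section Trajectories.
Context {R : realType}.
Notation mu := (@lebesgue_measure R).
Notation D := (@cell R).
Variables (d zeta kappa f : R).
Hypotheses (k0 : 0 < kappa) (k3 : 1 <= 3 * kappa ^+ 2).
Implicit Types (u v w b c g : R -> R[i]%C) (a be : R -> R -> R[i]%C).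

(** The equation at one point of space and time: [z], [z2] and [bz] are the values
    of the function, of its second space derivative and of its time
    derivative. *)
Definition equation_at (z z2 bz : R[i]%C) : Prop :=
  'i%C * bz = - ('i%C - zeta%:C%C) * z - d%:C%C * z2
            - (1 + 'i%C * kappa%:C%C) * `|z| ^+ 2 * z + 'i%C * f%:C%C.

(** The equation is solved for the cubic term since the cubic inequalities are its
    only use. *)
Lemma equation_at_cubic (z z2 bz : R[i]%C) : equation_at z z2 bz ->
  cubic_re kappa (complex.Re z) (complex.Im z) =
    complex.Re bz + complex.Re z - zeta * complex.Im z + d * complex.Im z2 - f /\
  cubic_im kappa (complex.Re z) (complex.Im z) =
    complex.Im bz + complex.Im z + zeta * complex.Re z - d * complex.Re z2.
Proof.
case: z z2 bz => [p q] [r s] [P Q]; rewrite /equation_at /cubic_re /cubic_im.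
have -> : `|(p +i* q)%C| ^+ 2 = (p ^+ 2 + q ^+ 2)%:C%C.
  by rewrite sqr_normc /= ; simpc; congr (_ +i* _)%C; ring.
simpc => -[e1 e2] /=; split; lra.
Qed.

(** The state of a solution at one instant: the function, its time derivative and
    representatives of its first two space derivatives. *)
Definition snapshot u b u1 u2 : Prop :=
  [/\ L2 u, L2 b, L2 u1 & L2 u2] /\
  [/\ is_weak_derivative u u1, is_weak_derivative u1 u2 &
      {ae mu, forall x, equation_at (u x) (u2 x) (b x)}].

Definition quartic u : R :=
  rint (fun x => (complex.Re (u x) ^+ 2 + complex.Im (u x) ^+ 2) ^+ 2).

(** The real inner product of i u and v. *)
Definition symplectic u v : R :=
  rint (fun x => complex.Re (u x) * complex.Im (v x) - complex.Im (u x) * complex.Re (v x)).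

Lemma L2normsq_Re_Im u : L2normsq u =
  rint (fun x => complex.Re (u x) ^+ 2 + complex.Im (u x) ^+ 2).
Proof. by rewrite L2normsqE; apply: eq_rint => x _; rewrite !expr2. Qed.

Lemma snapshot_dissipation u b u1 u2 v c v1 v2 :
  snapshot u b u1 u2 -> snapshot v c v1 v2 ->
  inner (fun x => u x - v x) (fun x => b x - c x) +
  L2normsq (fun x => u x - v x) + kappa / 4 * quartic (fun x => u x - v x) <= 0.
Proof.
move=> [[hu hb hu1 hu2] [wu wu1 eu]] [[hv hc hv1 hv2] [wv wv1 ev]].
have hw := L2B hu hv; have hw1 := L2B hu1 hv1; have hw2 := L2B hu2 hv2.
have hbc := L2B hb hc.
have ww := weakB hu hu1 hv hv1 wu wv; have ww1 := weakB hu1 hu2 hv1 hv2 wu1 wv1.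
rewrite innerC L2normsq_Re_Im.
apply: (energy_dissipation (d := d) (zeta := zeta) (L2_Re hw) (L2_Im hw)
  (L2_Re hw1) (L2_Im hw1) (L2_Re hw2) (L2_Im hw2) (L2_Re hbc) (L2_Im hbc)
  (weak_Re ww) (weak_Im ww) (weak_Re ww1) (weak_Im ww1) k0).
apply: ae_imply (ae_and eu ev) => x [e1 e2] _.
have := cubic_dissipative (complex.Re (u x)) (complex.Im (u x))
  (complex.Re (v x)) (complex.Im (v x)) k0 k3.
have [-> ->] := equation_at_cubic e1; have [-> ->] := equation_at_cubic e2.
rewrite !ReB !ImB; apply: le_trans.
by rewrite le_eqVlt; apply/orP; left; apply/eqP; ring.
Qed.

(** The second solution being constant, the gradient of the difference is the
    gradient [u1] itself. *)
Lemma snapshot_gradient u b u1 u2 (z : R[i]%C) :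
  snapshot u b u1 u2 -> snapshot (fun=> z) (fun=> 0) (fun=> 0) (fun=> 0) ->
  `|d| * L2normsq u1 <= `|symplectic b (fun x => u x - z)| +
   (`|zeta| + (9 + 3 * kappa) / 2 * (complex.Re z ^+ 2 + complex.Im z ^+ 2))
     * L2normsq (fun x => u x - z) +
   (5 + kappa) / 2 * quartic (fun x => u x - z).
Proof.
move=> [[hu hb hu1 hu2] [wu wu1 eu]] [[hv hc hv1 hv2] [wv wv1 ev]].
have hw := L2B hu hv.
have ww : is_weak_derivative (fun x => u x - z) u1.
  have := weakB hu hu1 hv hv1 wu wv.
  by rewrite (_ : (fun x => u1 x - 0) = u1)//; apply/funext => x; rewrite subr0.
rewrite !L2normsq_Re_Im.
apply: (gradient_bound (d := d) (zeta := zeta) (kappa := kappa) (L2_Re hw) (L2_Im hw)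
  (L2_Re hu1) (L2_Im hu1) (L2_Re hu2) (L2_Im hu2) (L2_Re hb) (L2_Im hb)
  (weak_Re ww) (weak_Im ww) (weak_Re wu1) (weak_Im wu1) k0).
  apply: ae_imply (ae_and eu ev) => x [e1 e2] _.
  have := cubic_dissipative (complex.Re (u x)) (complex.Im (u x))
    (complex.Re z) (complex.Im z) k0 k3.
  have [-> ->] := equation_at_cubic e1; have [-> ->] := equation_at_cubic e2.
  rewrite !ReB !ImB /=; apply: le_trans.
  by rewrite le_eqVlt; apply/orP; left; apply/eqP; ring.
apply: ae_imply (ae_and eu ev) => x [e1 e2] _.
have := cubic_cross (complex.Re (u x)) (complex.Im (u x))
    (complex.Re z) (complex.Im z) k0.
have [-> ->] := equation_at_cubic e1; have [-> ->] := equation_at_cubic e2.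
rewrite !ReB !ImB /=; apply: le_trans.
by rewrite le_eqVlt; apply/orP; left; apply/eqP; congr `|_|; ring.
Qed.

(** Convergence of the difference quotients in the square of the L2 norm. *)
Definition velocity a be (t : R) := forall e : R, 0 < e ->
  exists2 dl : R, 0 < dl & forall s : R, 0 <= s -> s != t -> `|s - t| < dl ->
    L2normsq (fun x => ((s - t)^-1)%:C%C * (a s x - a t x) - be t x) <= e.

Lemma L2normsqB_le u v : L2 u -> L2 v ->
  L2normsq (fun x => u x - v x) <= 2 * L2normsq u + 2 * L2normsq v.
Proof.
move=> hu hv; have := L2normsqD_le hu (L2Z (-1) hv); rewrite L2normsqZ//.
rewrite (@eq_L2normsq _ _ (fun x => u x - v x)); first lra.
by move=> x; rewrite rmorphN1 mulN1r.
Qed.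

Lemma L2_quotient (h : R) u v w : L2 u -> L2 v -> L2 w ->
  L2 (fun x => (h^-1)%:C%C * (u x - v x) - w x).
Proof. by move=> hu hv hw; apply: L2B => //; apply: L2Z; exact: L2B. Qed.

Lemma velocityB a be a' be' (t : R) :
  (forall s, 0 <= s -> L2 (a s)) -> (forall s, 0 <= s -> L2 (a' s)) ->
  0 <= t -> L2 (be t) -> L2 (be' t) ->
  velocity a be t -> velocity a' be' t ->
  velocity (fun s x => a s x - a' s x) (fun s x => be s x - be' s x) t.
Proof.
move=> ha ha' t0 hb hb' va va' e e0.
have e4 : 0 < e / 4 by lra.
have [d1 d10 H1] := va _ e4; have [d2 d20 H2] := va' _ e4.
exists (Num.min d1 d2); first by rewrite lt_min d10.
move=> s s0 st; rewrite lt_min => /andP[/(H1 s s0 st) k1 /(H2 s s0 st) k2].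
have := L2normsqB_le (L2_quotient (s - t) (ha s s0) (ha t t0) hb)
  (L2_quotient (s - t) (ha' s s0) (ha' t t0) hb').
rewrite (@eq_L2normsq _ (fun x => _ - _)
  (fun x => ((s - t)^-1)%:C%C * (a s x - a' s x - (a t x - a' t x)) - (be t x - be' t x))).
  lra.
by move=> x; ring.
Qed.

(** Expand the square norm of a (s) = a (t) + (s - t) (a_t + r), where the
    remainder r tends to 0 in L2. *)
Lemma velocity_slope a be (t : R) : (forall s : R, 0 <= s -> L2 (a s)) ->
  0 <= t -> L2 (be t) -> velocity a be t ->
  has_slope (fun s => L2normsq (a s)) t (2 * inner (a t) (be t)).
Proof.
move=> ha t0 hb va e e0.
have hat := ha t t0.
have A0 := L2normsq_ge0 (a t); have B0 := L2normsq_ge0 (be t).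
set A := L2normsq (a t) in A0 *; set B := L2normsq (be t) in B0 *.
(* each of the three error terms is made at most e / 3; eta bounds the square norm of r *)
pose lam := e / (3 * (1 + A)); pose eta := lam * (e / 3).
have A1 : 0 < 3 * (1 + A) by lra.
have lam0 : 0 < lam by rewrite divr_gt0.
have eta0 : 0 < eta by rewrite mulr_gt0// divr_gt0.
have lamA : lam * (1 + A) = e / 3 by rewrite /lam; field; rewrite gt_eqF//; lra.
have [d1 d10 H1] := va _ eta0.
have C0 : 0 < 3 * (2 * B + 2 * eta + 1) by lra.
exists (Num.min d1 (e / (3 * (2 * B + 2 * eta + 1)))).
  by rewrite lt_min d10 divr_gt0.
move=> s s0; rewrite lt_min => /andP[sd1].
rewrite ltr_pdivlMr// => sd2.
have [->|st] := eqVneq s t.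
  by rewrite !subrr normr0 mul0r subr0 normr0 mulr0.
have h0 : s - t != 0 by rewrite subr_eq0.
have {}H1 := H1 s s0 st sd1.
have hr := L2_quotient (s - t) (ha s s0) hat hb.
set r := (fun x => _) in H1 hr.
have hW := L2D hb hr.
have eW : a s = (fun x => a t x + (s - t)%:C%C * (be t x + r x)).
  apply/funext => x; rewrite /r [be t x + _]addrC subrK mulrA -rmorphM/= divff//.
  by rewrite rmorph1 mul1r addrC subrK.
have nW := L2normsqD_le hb hr; rewrite -/B in nW.
have W0 := L2normsq_ge0 (fun x => be t x + r x).
have yg := inner_young lam0 hat hr; rewrite -/A in yg.
have eN : L2normsq (a s) = A + 2 * (s - t) * (inner (a t) (be t) + inner (a t) r) +
    (s - t) ^+ 2 * L2normsq (fun x => be t x + r x).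
  by rewrite eW L2normsq_lin// innerDr.
rewrite eN; set nn := L2normsq (fun x => be t x + r x) in nW W0 *.
have -> : A + 2 * (s - t) * (inner (a t) (be t) + inner (a t) r) + (s - t) ^+ 2 * nn
   - A - (s - t) * (2 * inner (a t) (be t)) =
   (s - t) * (2 * inner (a t) r + (s - t) * nn) by ring.
rewrite normrM mulrC ler_wpM2r//.
apply: (le_trans (ler_normD _ _)); rewrite [`|_ * nn|]normrM (ger0_norm W0).
have l1 : lam^-1 * L2normsq r <= e / 3.
  by rewrite mulrC ler_pdivrMr// mulrC.
have l2 : `|s - t| * nn <= `|s - t| * (2 * B + 2 * eta) by rewrite ler_wpM2l//; lra.
have := normr_ge0 (s - t); lra.
Qed.

Definition trajectory a be := forall t : R, 0 <= t ->
  (exists u1 u2, snapshot (a t) (be t) u1 u2) /\ velocity a be t.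

Lemma trajectory_contraction a be a' be' : trajectory a be -> trajectory a' be' ->
  forall t : R, 0 <= t -> L2normsq (fun x => a t x - a' t x) <=
    expR (- 2 * t) * L2normsq (fun x => a 0 x - a' 0 x).
Proof.
move=> ta ta'.
have ha s : 0 <= s -> L2 (a s) by move=> /ta [[u1 [u2 [[]]]]].
have hb s : 0 <= s -> L2 (be s) by move=> /ta [[u1 [u2 [[]]]]].
have ha' s : 0 <= s -> L2 (a' s) by move=> /ta' [[u1 [u2 [[]]]]].
have hb' s : 0 <= s -> L2 (be' s) by move=> /ta' [[u1 [u2 [[]]]]].
apply: (@gronwall R (fun t => L2normsq (fun x => a t x - a' t x))
  (fun t => 2 * inner (fun x => a t x - a' t x) (fun x => be t x - be' t x))).
- move=> t t0; apply: (@velocity_slope (fun s x => a s x - a' s x)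
    (fun s x => be s x - be' s x)) => //.
  + by move=> s s0; apply: L2B; [exact: ha|exact: ha'].
  + by apply: L2B; [exact: hb|exact: hb'].
  + by apply: velocityB; [exact: ha|exact: ha'|..] => //;
      [exact: hb|exact: hb'|exact: (ta t t0).2|exact: (ta' t t0).2].
- move=> t t0.
  have [[u1 [u2 su]] _] := ta t t0; have [[v1 [v2 sv]] _] := ta' t t0.
  have := snapshot_dissipation su sv.
  have : 0 <= kappa / 4 * quartic (fun x => a t x - a' t x).
    by rewrite mulr_ge0 ?divr_ge0 ?(ltW k0)// rint_ge0// => x _; exact: sqr_ge0.
  lra.
Qed.

Lemma trajectory_shift a be (h : R) : 0 <= h -> trajectory a be ->
  trajectory (fun t => a (t + h)) (fun t => be (t + h)).
Proof.
move=> h0 ta t t0; have [sn va] := ta (t + h) (addr_ge0 t0 h0); split=> // e e0.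
have [dl dl0 H] := va e e0; exists dl => // s s0 st sdl.
have e1 : s + h - (t + h) = s - t by ring.
have := H (s + h) (addr_ge0 s0 h0); rewrite e1; apply => //.
by apply: contra_neq st => /addIr.
Qed.

Lemma trajectory_cst (z : R[i]%C) :
  snapshot (fun=> z) (fun=> 0) (fun=> 0) (fun=> 0) ->
  trajectory (fun _ _ => z) (fun _ _ => 0).
Proof.
move=> sz t t0; split; first by exists (fun=> 0), (fun=> 0).
move=> e e0; exists 1 => // s _ _ _.
rewrite (@eq_L2normsq _ _ (fun=> 0)); last by move=> x; rewrite subrr mulr0 subr0.
by rewrite L2normsq_Re_Im /= expr0n/= addr0 rint_cst mul0r ltW.
Qed.

(** The difference quotients at time t and at time 0 with the same step h are
    compared by contraction, and each of them is close to the corresponding time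
    derivative for h small. The square norms are compared through
    |u + v|^2 <= 2 |u|^2 + 2 |v|^2, which costs the factor 4. *)
Lemma trajectory_velocity_bound a be : trajectory a be ->
  forall t : R, 0 <= t -> L2normsq (be t) <= 4 * L2normsq (be 0) + 1.
Proof.
move=> ta t t0.
have ha s : 0 <= s -> L2 (a s) by move=> /ta [[u1 [u2 [[]]]]].
have hb s : 0 <= s -> L2 (be s) by move=> /ta [[u1 [u2 [[]]]]].
(* the two errors add up to 2 / 6 + 4 / 6 = 1 *)
have e0 : 0 < 1 / 6 :> R by lra.
have [d1 d10 H1] := (ta t t0).2 _ e0; have [d2 d20 H2] := (ta 0 (lexx _)).2 _ e0.
pose h := Num.min d1 d2 / 2.
have m0 : 0 < Num.min d1 d2 by rewrite lt_min d10.
have h0 : 0 < h by rewrite divr_gt0.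
have hd : h < Num.min d1 d2 by rewrite /h; lra.
move: hd; rewrite lt_min => /andP[hd1 hd2].
have th0 : 0 <= t + h by rewrite addr_ge0// ltW.
have {}H1 := H1 (t + h) th0.
have {}H2 := H2 h (ltW h0).
rewrite addrAC subrr add0r (gtr0_norm h0) in H1.
rewrite subr0 (gtr0_norm h0) in H2.
have tneq : t + h != t by rewrite -subr_eq0 addrAC subrr add0r lt0r_neq0.
have {}H1 := H1 tneq hd1; have {}H2 := H2 (lt0r_neq0 h0) hd2.
have hat := ha t t0; have hath := ha _ th0; have ha0 := ha 0 (lexx _).
have hah := ha h (ltW h0).
have hbt := hb t t0; have hb0 := hb 0 (lexx _).
have q1 := L2Z (h^-1) (L2B hath hat); have q2 := L2Z (h^-1) (L2B hah ha0).
have B1 := L2normsqB_le q1 (L2B q1 hbt).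
rewrite (@eq_L2normsq _ (fun x => _ - _) (be t)) in B1; last by move=> x; ring.
have B2 := L2normsqD_le (L2B q2 hb0) hb0.
rewrite (@eq_L2normsq _ (fun x => _ + _) (fun x => (h^-1)%:C%C * (a h x - a 0 x))) in B2;
  last by move=> x; ring.
have ctr := trajectory_contraction (trajectory_shift (ltW h0) ta) ta t0.
have Q : L2normsq (fun x => (h^-1)%:C%C * (a (t + h) x - a t x)) <=
    L2normsq (fun x => (h^-1)%:C%C * (a h x - a 0 x)).
  rewrite !L2normsqZ//; try exact: L2B.
  rewrite ler_wpM2l ?sqr_ge0//; apply: (le_trans ctr); rewrite add0r.
  rewrite ler_piMl ?L2normsq_ge0// expR_le1. lra.
lra.
Qed.

End Trajectories.

(** * Exponential convergence to a constant *)

Section Constant.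
Context {R : realType}.
Notation mu := (@lebesgue_measure R).
Notation D := (@cell R).
Variables (d zeta kappa f : R).
Hypotheses (k0 : 0 < kappa) (k3 : 1 <= 3 * kappa ^+ 2).
Implicit Types (u v w b g : R -> R[i]%C) (a be : R -> R -> R[i]%C).

Lemma equation_at_intro (p q : R) :
  0 = - p + zeta * q + cubic_re kappa p q + f ->
  0 = - q - zeta * p + cubic_im kappa p q ->
  equation_at d zeta kappa f (p +i* q)%C 0 0.
Proof.
rewrite /equation_at /cubic_re /cubic_im => e1 e2.
have -> : `|(p +i* q)%C| ^+ 2 = (p ^+ 2 + q ^+ 2)%:C%C.
  by rewrite sqr_normc /= ; simpc; congr (_ +i* _)%C; ring.
simpc; apply/eqP; rewrite eq_complex /=; apply/andP; split; apply/eqP; lra.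
Qed.

(** The equation for a constant z is f = ((1 + kappa r) + i (zeta - r)) z with
    r = |z|^2. Taking square moduli gives a real equation for r, solved by the
    intermediate value theorem between 0 and f^2; since 1 + kappa r > 0, the value
    of r determines z. *)
Lemma exists_constant_solution :
  exists z : R[i]%C, equation_at d zeta kappa f z 0 0.
Proof.
pose D_ (r : R) := (1 + kappa * r) ^+ 2 + (zeta - r) ^+ 2.
pose g (r : R) := r * D_ r.
have F0 := sqr_ge0 f.
have cg : {within `[0, f ^+ 2], continuous g}.
  apply: continuous_subspaceT => x; apply: cvgM; first exact: cvg_id.
  have c1 : (fun y => 1 + kappa * y) y @[y --> x] --> 1 + kappa * x.
    by apply: cvgD; [exact: cvg_cst|apply: cvgM; [exact: cvg_cst|exact: cvg_id]].
  have c2 : (fun y => zeta - y) y @[y --> x] --> zeta - x.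
    by apply: cvgB; [exact: cvg_cst|exact: cvg_id].
  by apply: cvgD; [exact: (cvgM c1 c1)|exact: (cvgM c2 c2)].
have [|r /=] := IVT (v := f ^+ 2) F0 cg.
  have g0 : g 0 = 0 by rewrite /g mul0r.
  have gf : f ^+ 2 <= g (f ^+ 2).
    rewrite /g /D_ ler_peMr//.
    have := sqr_ge0 (zeta - f ^+ 2); have := mulr_ge0 (ltW k0) F0; nra.
  by rewrite g0 ge_min le_max F0 gf orbT.
rewrite in_itv/= => /andP[r0 _] gr.
have kr : 0 <= kappa * r by rewrite mulr_ge0// ltW.
have D0 : 0 < D_ r.
  by rewrite /D_ ltr_wpDr ?sqr_ge0// exprn_gt0//; lra.
exists ((f * (1 + kappa * r) / D_ r) +i* (- f * (zeta - r) / D_ r))%C.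
have rE : (f * (1 + kappa * r) / D_ r) ^+ 2 + (- f * (zeta - r) / D_ r) ^+ 2 = r.
  have -> : (f * (1 + kappa * r) / D_ r) ^+ 2 + (- f * (zeta - r) / D_ r) ^+ 2 =
      f ^+ 2 * D_ r / D_ r ^+ 2 by rewrite /D_; field; rewrite -/(D_ r) gt_eqF.
  by rewrite -gr /g; field; rewrite gt_eqF.
apply: equation_at_intro; rewrite /cubic_re /cubic_im rE;
  by rewrite /D_; field; rewrite -/(D_ r) gt_eqF.
Qed.

Lemma snapshot_cst (z : R[i]%C) : equation_at d zeta kappa f z 0 0 ->
  snapshot d zeta kappa f (fun=> z) (fun=> 0) (fun=> 0) (fun=> 0).
Proof.
move=> ez; split; first by split; exact: L2_cst.
by split; [exact: weak_cst|exact: weak_cst|exact: aeW].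
Qed.

Lemma symplectic_young (c : R) u v : 0 < c -> L2 u -> L2 v ->
  `|2 * symplectic u v| <= c * L2normsq u + c^-1 * L2normsq v.
Proof.
move=> c0 hu hv.
pose v' x := (complex.Im (v x) +i* - complex.Re (v x))%C.
have hv' : L2 v'.
  apply: L2_intro; first by move=> x; rewrite /v'; case: hv => ->.
    exact: L2_Im.
  exact: rL2N (L2_Re hv).
have -> : symplectic u v = inner u v'.
  by apply: eq_rint => x _ /=; ring.
have -> : L2normsq v = L2normsq v'.
  by rewrite !L2normsq_Re_Im; apply: eq_rint => x _ /=; ring.
exact: inner_young.
Qed.

(** With E = exp (- t), contraction gives |w|_2^2 <= E^2 N0, and the pairings of w
    with the bounded a_t are at most of order E by Young's inequality with weight
    E^-1. Dissipation then bounds the quartic term and [snapshot_gradient] the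
    gradient, both of order E. *)
Lemma trajectory_decay a be (z : R[i]%C) : d != 0 ->
  trajectory d zeta kappa f a be -> equation_at d zeta kappa f z 0 0 ->
  exists K : R, forall t u1 u2, 0 <= t -> snapshot d zeta kappa f (a t) (be t) u1 u2 ->
    L2normsq (fun x => a t x - z) + L2normsq u1 <= K * expR (- t).
Proof.
move=> d0 ta ez; have sz := snapshot_cst ez; have tz := trajectory_cst sz.
pose N0 := L2normsq (fun x => a 0 x - z).
pose B := 4 * L2normsq (be 0) + 1.
pose A := `|zeta| + (9 + 3 * kappa) / 2 * (complex.Re z ^+ 2 + complex.Im z ^+ 2).
pose C := (N0 + B) / 2 + A * N0 + (5 + kappa) / 2 * (2 / kappa * (N0 + B)).
exists (N0 + C / `|d|) => t u1 u2 t0 st.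
have [[ha hb hu1 hu2] [wu wu1 eu]] := st.
have hz := L2_cst z; have hw := L2B ha hz.
have E0 := expR_gt0 (- t); set E := expR (- t) in E0 *.
have E1 : E <= 1 by rewrite /E expR_le1; lra.
have N00 : 0 <= N0 by exact: L2normsq_ge0.
have Nt : L2normsq (fun x => a t x - z) <= E ^+ 2 * N0.
  have := trajectory_contraction k0 k3 ta tz t0.
  by rewrite (_ : expR (- 2 * t) = E ^+ 2)// /E expr2 -expRD; congr expR; lra.
have Bt : L2normsq (be t) <= B := trajectory_velocity_bound k0 k3 ta t0.
have w0 := L2normsq_ge0 (fun x => a t x - z).
have b0 := L2normsq_ge0 (be t).
set N := L2normsq (fun x => a t x - z) in Nt w0 *.
have NE : N <= E * N0 by apply: (le_trans Nt); rewrite ler_wpM2r// expr2 ler_piMl// ltW.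
have young : E^-1 * N + E * L2normsq (be t) <= E * (N0 + B).
  rewrite mulrDr lerD//; last by rewrite ler_wpM2l// ltW.
  by rewrite ler_pdivrMl// mulrA -expr2.
have in1 := inner_young (u := fun x => a t x - z) (v := be t) (c := E^-1).
rewrite invrK invr_gt0 in in1; have {}in1 := le_trans (in1 E0 hw hb) young.
have sy1 := symplectic_young E0 hb hw.
have {}sy1 : `|2 * symplectic (be t) (fun x => a t x - z)| <= E * (N0 + B).
  by apply: (le_trans sy1); rewrite addrC.
have diss := snapshot_dissipation k0 k3 st sz.
have grad := snapshot_gradient k0 k3 st sz.
have eb : (fun x => be t x - 0) = be t by apply/funext => x; rewrite subr0.
rewrite eb -/N in diss; rewrite -/N -/A in grad.
rewrite !normrM ger0_norm// in in1 sy1.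
set q := quartic _ in diss grad.
have q1 : q <= 2 / kappa * (N0 + B) * E.
  have : kappa / 4 * q <= E * (N0 + B) / 2.
    have := lerNnormlW (lexx `|inner (fun x => a t x - z) (be t)|); lra.
  rewrite -(ler_pM2l (x := 4 / kappa)) ?divr_gt0//.
  have -> : 4 / kappa * (kappa / 4 * q) = q by field; rewrite gt_eqF.
  move/le_trans; apply; rewrite le_eqVlt; apply/orP; left; apply/eqP.
  by field; rewrite gt_eqF.
have A0 : 0 <= A.
  by rewrite addr_ge0// mulr_ge0 ?addr_ge0 ?sqr_ge0//; have := ltW k0; lra.
have AN := ler_wpM2l A0 NE.
have k5 : 0 <= (5 + kappa) / 2 by have := ltW k0; lra.
have kq := ler_wpM2l k5 q1.
have dn : 0 < `|d| by rewrite normr_gt0.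
have X1 : L2normsq u1 <= C / `|d| * E.
  rewrite mulrAC ler_pdivlMr// mulrC; apply: (le_trans grad); rewrite /C; lra.
by rewrite mulrDl lerD// mulrC.
Qed.

End Constant.

(** * From the Sobolev formulation to trajectories *)

Section Sobolev.
Context {R : realType}.
Notation mu := (@lebesgue_measure R).
Implicit Types (u v w b g : R -> R[i]%C) (a be : R -> R -> R[i]%C).

(** The chosen weak derivative is meaningful whenever one exists. *)
Lemma wderivP u : (exists g, L2 g /\ is_weak_derivative u g) ->
  L2 (wderiv u) /\ is_weak_derivative u (wderiv u).
Proof. by move=> h; exact: (xgetPex (fun=> 0) h). Qed.

Lemma sobolev2_snapshot (d zeta kappa f : R) u b : sobolev 2 u -> sobolev 2 b ->
  {ae mu, forall x, equation_at d zeta kappa f (u x) (wderivn 2 u x) (b x)} ->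
  snapshot d zeta kappa f u b (wderiv u) (wderiv (wderiv u)).
Proof.
move=> [hu du] [hb _] eu.
have [h1 w1] := wderivP (du 0%N isT); have [h2 w2] := wderivP (du 1%N isT).
exact: (conj (And4 hu hb h1 h2) (And3 w1 w2 eu)).
Qed.

Lemma L2normsq_le_sobolev k u : L2normsq u <= sobolev_norm k u ^+ 2.
Proof.
rewrite /sobolev_norm sqr_sqrtr; last by apply: sumr_ge0 => i _; exact: L2normsq_ge0.
rewrite big_ord_recl /= lerDl; apply: sumr_ge0 => i _; exact: L2normsq_ge0.
Qed.

Lemma time_derivative_velocity k a be (t : R) : is_time_derivative k a be -> 0 <= t ->
  velocity a be t.
Proof.
move=> /[apply] -[_ cv] e e0.
have se : 0 < Num.sqrt e by rewrite sqrtr_gt0.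
move/cvgrPdist_lt : cv => /(_ _ se) [dl /= dl0 H].
exists dl => // s s0 st sdl.
have := H s; rewrite /ball_ /= distrC => /(_ sdl (conj s0 st)).
set n := sobolev_norm _ _; rewrite sub0r normrN => k1.
apply: (le_trans (L2normsq_le_sobolev k _)); rewrite -/n.
have n0 : 0 <= n by exact: sqrtr_ge0.
rewrite ger0_norm// in k1.
rewrite -[leRHS](sqr_sqrtr (ltW e0)) ler_sqr ?nnegrE ?sqrtr_ge0//.
exact: ltW.
Qed.

(** The chosen weak derivative may differ from [u1] on a null set only. *)
Lemma sobolev_norm1E u u1 : L2 u -> L2 u1 -> is_weak_derivative u u1 ->
  sobolev_norm 1 u = Num.sqrt (L2normsq u + L2normsq u1).
Proof.
move=> hu hu1 wu.
have [hd wd] := wderivP (ex_intro _ u1 (conj hu1 wu)).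
by rewrite /sobolev_norm !big_ord_recl big_ord0 addr0 /= (weak_unique_normsq hu1 hd wu wd).
Qed.

Lemma L2_weakB_cst u u1 (z : R[i]%C) : L2 u -> L2 u1 -> is_weak_derivative u u1 ->
  is_weak_derivative (fun x => u x - z) u1.
Proof.
move=> hu hu1 wu; have := weakB hu hu1 (L2_cst z) (L2_cst 0) wu (weak_cst z).
by rewrite (_ : (fun x => u1 x - 0) = u1)//; apply/funext => x; rewrite subr0.
Qed.

(** The weak derivatives chosen for a (t) - z and for a (t) are a priori unrelated;
    uniqueness lets the second one compute the H^1 norm of the first. *)
Lemma global_solution_converges (d zeta kappa f : R) (phi : R -> R[i]%C) a :
  d != 0 -> 0 < kappa -> 1 <= 3 * kappa ^+ 2 ->
  global_solution d zeta kappa f phi a ->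
  exists c : R[i]%C, converges_at_infinity 1 a (fun _ => c).
Proof.
move=> d0 k0 k3 [_ [s2 _] _ _ [be [tbe ebe]]].
have sn t : 0 <= t ->
    snapshot d zeta kappa f (a t) (be t) (wderiv (a t)) (wderiv (wderiv (a t))).
  move=> t0; apply: sobolev2_snapshot; [exact: s2|exact: (tbe t t0).1|exact: ebe].
have ta : trajectory d zeta kappa f a be.
  move=> t t0; split; last exact: time_derivative_velocity tbe t0.
  by exists (wderiv (a t)), (wderiv (wderiv (a t))); exact: sn.
have [z ez] := exists_constant_solution d zeta f k0.
have [K HK] := trajectory_decay k0 k3 d0 ta ez.
exists z.
have near0 : \forall t \near +oo, 0 <= t :> R by exact: nbhs_pinfty_ge.
split.
  apply: filterS near0 => t t0; have [[ha _ h1 _] [w1 _ _]] := sn t t0.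
  split; first exact: L2B ha (L2_cst z).
  by case=> // _; exists (wderiv (a t)); split => //; exact: L2_weakB_cst.
apply/cvgrPdist_le => e e0.
have cvE : K * expR (- t) @[t --> +oo] --> (K * 0 : R).
  by apply: cvgM; [exact: cvg_cst|exact: cvgr_expR].
rewrite mulr0 in cvE; move/cvgrPdist_le : cvE => /(_ (e ^+ 2)).
rewrite exprn_gt0// => /(_ isT) nearE.
apply: filterS2 near0 nearE => t t0 tE.
have [[ha _ h1 _] [w1 _ _]] := sn t t0.
rewrite (sobolev_norm1E (L2B ha (L2_cst z)) h1 (L2_weakB_cst z ha h1 w1)).
rewrite sub0r normrN ger0_norm ?sqrtr_ge0//.
rewrite -[leRHS](ger0_norm (ltW e0)) -sqrtr_sqr ler_wsqrtr//.
apply: (le_trans (HK t _ _ t0 (sn t t0))).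
by move: tE; rewrite sub0r normrN; apply: le_trans; exact: ler_norm.
Qed.

End Sobolev.

(** * Stationary solutions *)

Section Stationary.
Context {R : realType}.
Implicit Types (J : R -> R).

(** A nondecreasing periodic function is squeezed between its values one period
    apart, hence constant. *)
Lemma periodic_nondecreasing_derive0 J (J' : R -> R) (P : R) : 0 < P -> periodic J P ->
  (forall x : R, is_derive x 1 J (J' x)) -> (forall x, 0 <= J' x) ->
  forall x, J' x = 0.
Proof.
move=> P0 pJ dJ J0 x.
have cJ := is_derive_continuous dJ.
have mono (s t : R) : s <= t -> J s <= J t.
  move=> st; have [c _ e] := MVT_segment st (fun y _ => dJ y) (continuous_subspaceT cJ).
  by rewrite -subr_ge0 e mulr_ge0// subr_ge0.
have h0 : is_derive x 1 (cst (J x)) (0 : R) by exact: is_derive_cst.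
have h : is_derive x 1 J 0.
  apply: near_eq_is_derive h0; near=> y.
  have yx : `|x - y| < P by near: y; exact: (nbhsx_ballx x P P0).
  move: yx; rewrite ltr_norml => /andP[yx1 yx2].
  rewrite /cst; apply/eqP; rewrite eq_le; have [xy|yx] := leP x y.
    rewrite mono// -(pJ x) mono//; lra.
  rewrite andbC mono ?(ltW yx)//= -(pJ y) mono//; lra.
by rewrite -(@derive_val _ _ _ _ _ _ _ (dJ x)) (@derive_val _ _ _ _ _ _ _ h).
Unshelve. all: by end_near. Qed.

(** With w = u - z for the constant solution z, the derivative of
    J = - d Im (u' conj w) involves only u'' because u' conj u' is real; by the
    equation and [cubic_dissipative] it is at least |w|^2. *)
Lemma stationary_solution_constant (d zeta kappa f : R) (u : R -> R[i]%C) :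
  0 < kappa -> 1 <= 3 * kappa ^+ 2 -> stationary_solution d zeta kappa f u ->
  exists c : R[i]%C, forall x : R, u x = c.
Proof.
move=> k0 k3 [pu du ddu eu].
have [z ez] := exists_constant_solution d zeta f k0.
exists z.
pose p x := complex.Re (u x); pose q x := complex.Im (u x).
pose p1 := p^`()%classic; pose q1 := q^`()%classic.
pose p2 := p1^`()%classic; pose q2 := q1^`()%classic.
have dp (x : R) : is_derive x 1 p (p1 x).
  by rewrite /p1 derive1E; apply: DeriveDef => //; exact: (du x).1.
have dq (x : R) : is_derive x 1 q (q1 x).
  by rewrite /q1 derive1E; apply: DeriveDef => //; exact: (du x).2.
have dp1 (x : R) : is_derive x 1 p1 (p2 x).
  by rewrite /p2 derive1E; apply: DeriveDef => //; exact: (ddu x).1.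
have dq1 (x : R) : is_derive x 1 q1 (q2 x).
  by rewrite /q2 derive1E; apply: DeriveDef => //; exact: (ddu x).2.
have eqx x : equation_at d zeta kappa f (u x) (p2 x +i* q2 x)%C 0.
  rewrite /equation_at mulr0; apply/esym; rewrite -[RHS](eu x).
  rewrite (_ : cderive (cderive u) x = (p2 x +i* q2 x)%C)//.
  by ring.
pose J x := d * (p1 x * (q x - complex.Im z) - q1 x * (p x - complex.Re z)).
pose J' x := d * (p2 x * (q x - complex.Im z) - q2 x * (p x - complex.Re z)).
have dJ (x : R) : is_derive x 1 J (J' x).
  have m1 := @is_deriveM R R p1 _ x 1 _ _ (dp1 x) (is_derive_subr_cst (complex.Im z) (dq x)).
  have m2 := @is_deriveM R R q1 _ x 1 _ _ (dq1 x) (is_derive_subr_cst (complex.Re z) (dp x)).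
  have m3 := @is_deriveB R R R _ _ x 1 _ _ m1 m2.
  have := @is_deriveM R R (cst d) _ x 1 _ _ (is_derive_cst _ _ _) m3.
  move/is_derive_congr; apply=> //.
  by rewrite /GRing.scale/= /J'; ring.
have mod2 x : (p x - complex.Re z) ^+ 2 + (q x - complex.Im z) ^+ 2 <= J' x.
  have := cubic_dissipative (p x) (q x) (complex.Re z) (complex.Im z) k0 k3.
  have [-> ->] := equation_at_cubic (eqx x); have [-> ->] := equation_at_cubic ez.
  rewrite /= -/(p x) -/(q x).
  have Q0 : 0 <= kappa / 4 *
      ((p x - complex.Re z) ^+ 2 + (q x - complex.Im z) ^+ 2) ^+ 2.
    by rewrite mulr_ge0 ?sqr_ge0// divr_ge0// ltW.
  by move=> h; rewrite /J'; lra.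
have pp : periodic p period by move=> x; rewrite /p pu.
have pq : periodic q period by move=> x; rewrite /q pu.
have pJ : periodic J period.
  by move=> x; rewrite /J pp pq (periodic_derive pp dp) (periodic_derive pq dq).
have J0 := periodic_nondecreasing_derive0 period_gt0 pJ dJ.
have {}J0 := J0 (fun x => le_trans (addr_ge0 (sqr_ge0 _) (sqr_ge0 _)) (mod2 x)).
move=> x; have := mod2 x; rewrite J0 => h.
have P0 := sqr_ge0 (p x - complex.Re z); have Q0 := sqr_ge0 (q x - complex.Im z).
have /eqP : (p x - complex.Re z) ^+ 2 = 0 by lra.
have /eqP : (q x - complex.Im z) ^+ 2 = 0 by lra.
rewrite !sqrf_eq0 !subr_eq0 => /eqP qz /eqP pz.
by rewrite [LHS]complexE [RHS]complexE -/(p x) -/(q x) pz qz.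
Qed.

End Stationary.

(** * The theorem *)

Lemma kappa_bounds (R : realType) (kappa : R) : (Num.sqrt 3)^-1 <= kappa ->
  0 < kappa /\ 1 <= 3 * kappa ^+ 2.
Proof.
move=> h; have s0 : 0 < Num.sqrt (3 : R) by rewrite sqrtr_gt0.
have k0 : 0 < kappa by apply: lt_le_trans h; rewrite invr_gt0.
split=> //.
have : 1 <= kappa * Num.sqrt 3 by rewrite -ler_pdivrMr// div1r.
have e : Num.sqrt (3 : R) ^+ 2 = 3 by rewrite sqr_sqrtr.
rewrite -[X in X * _ ^+ 2]e -exprMn mulrC => k1.
by rewrite exprn_ege1.
Qed.

Theorem theorem4 (R : realType) (d zeta f kappa : R)
    (hd : d != 0) (hkappa : (Num.sqrt 3)^-1 <= kappa) :
  (forall (phi : R -> R[i]%C) (a : R -> R -> R[i]%C),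
     sobolev 4 phi -> global_solution d zeta kappa f phi a ->
     Ccurve 0 4 a /\
     exists c : R[i]%C, converges_at_infinity 1 a (fun _ => c)) /\
  (forall u : R -> R[i]%C, stationary_solution d zeta kappa f u ->
     exists c : R[i]%C, forall x : R, u x = c).
Proof.
have [k0 k3] := kappa_bounds hkappa.
split; last by move=> u; exact: stationary_solution_constant.
move=> phi a _ sol; split; first by case: sol.
exact: global_solution_converges sol.
Qed.
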